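(* Let $M$ be a Riemann surface and let $\varphi:M\to G_k(\mathbb C^n)$ be a harmonic map of finite uniton number. Then either $\varphi$ is strongly isotropic, or its first return map $c(\varphi)$ is nilpotent, i.e. $c(\varphi)^j=0$ for some $j\in\mathbb N$.
   Context: Riemann surfaces are connected, as usual; $z$ is a local complex coordinate. Harmonic maps and finite uniton number. A smooth map $\varphi:M\to\mathrm U(n)$ is harmonic iff, with $A^\varphi_z=\frac12\varphi^{-1}\partial_z\varphi$, $A^\varphi_{\bar z}=\frac12\varphi^{-1}\partial_{\bar z}\varphi$, one has $\partial_{\bar z}A^\varphi_z+\partial_zA^\varphi_{\bar z}=0$. An extended solution associated to $\varphi$ is a smooth $\Phi:S^1\times M\to\mathrm U(n)$ with $\Phi(1,\cdot)=I$ and $\Phi^{-1}d\Phi=(1-\lambda^{-1})A^\varphi_z\,dz+(1-\lambda)A^\varphi_{\bar z}\,d\bar z$. $\varphi$ is of finite uniton number if there is an associated extended solution defined on all of $M$ that is a trigonometric polynomial $\sum_{k=-r}^sC_k(z)\lambda^k$ ($C_k$ smooth) in $\lambda\in S^1$. Grassmannians. $G_k(\mathbb C^n)$ is the Grassmannian of $k$-dimensional subspaces of $\mathbb C^n$, embedded in $\mathrm U(n)$ by the totally geodesic Cartan embedding $\alpha\mapsto\pi_\alpha-\pi_\alpha^\perp$ ($\pi_\alpha$ the Hermitian projection onto $\alpha$, $\pi_\alpha^\perp=\pi_{\alpha^\perp}$); harmonicity and finiteness of the uniton number of a map into $G_k(\mathbb C^n)$ are those of its composition with this embedding. Such a map is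 identified with a rank $k$ subbundle $\varphi$ of $M\times\mathbb C^n$. Second fundamental forms and Gauss bundles. For mutually orthogonal subbundles $\varphi,\psi$ of $M\times\mathbb C^n$, $A'_{\varphi,\psi}:\varphi\to\psi$ is $A'_{\varphi,\psi}(s)=\pi_\psi\,\partial_zs$; $A'_\varphi:=A'_{\varphi,\varphi^\perp}$ (so $A^\varphi_z|\varphi=-A'_\varphi$). For harmonic $\varphi$, the Gauss bundle $G'(\varphi)$ is the image of $A'_\varphi$, extended over the isolated points where its rank drops to a subbundle of $M\times\mathbb C^n$; it is again harmonic. Put $G^{(0)}(\varphi)=\varphi$, $G^{(i+1)}(\varphi)=G'(G^{(i)}(\varphi))$. Isotropy. The isotropy order of $\varphi$ is the greatest $t\in\{1,2,\dots,\infty\}$ such that $\varphi$ is orthogonal to $G^{(i)}(\varphi)$ for all $i$ with $1\le i\le t$ (for all $i\ge1$ when $t=\infty$). $\varphi$ is strongly isotropic if $t=\infty$; otherwise it is of finite isotropy order. For $\varphi$ of finite isotropy order $t$ the first return map is the bundle endomorphism of $\varphi$ $$c(\varphi)=\pi_\varphi\circ A'_{G^{(t)}(\varphi)}\circ A'_{G^{(t-1)}(\varphi)}\circ\cdots\circ A'_{G^{(1)}(\varphi)}\circ A'_\varphi .$$ *)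

(* Defs.v *)
From HB Require Import structures.
From mathcomp Require Import all_boot all_order all_algebra.
From mathcomp Require Import complex.
From mathcomp Require Import all_classical all_reals all_analysis.
From mathcomp Require Import ring.

Set Implicit Arguments.
Unset Strict Implicit.
Unset Printing Implicit Defensive.

Import Order.TTheory GRing.Theory Num.Theory.
Import numFieldNormedType.Exports.

Local Open Scope classical_set_scope.
Local Open Scope ring_scope.
Local Open Scope complex_scope.
Local Open Scope sesquilinear_scope.

(* A constant rather than R[i] itself, so that its ring structure and topology
   are all inferred from the one numClosedFieldType instance. *)
Definition Cplx (R : realType) : numClosedFieldType := R[i].

(* chart_inv is only meaningful on the image of chart_dom. *)
Record chart (R : realType) (M : topologicalType) := Chart {
  chart_dom : set M;
  chart_map :> M -> Cplx R;
  chart_inv : Cplx R -> M;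
  chart_dom_open : open chart_dom;
  chart_img_open : open (chart_map @` chart_dom);
  chart_mapK : forall p, chart_dom p -> chart_inv (chart_map p) = p;
  chart_map_continuous :
    forall p, chart_dom p -> {for p, continuous chart_map};
  chart_inv_continuous :
    forall z, (chart_map @` chart_dom) z -> {for z, continuous chart_inv}
}.

(* Differentiability of the transition map is over the field Cplx R. *)
Definition compatible (R : realType) (M : topologicalType) (a b : chart R M) :=
  forall p, chart_dom a p -> chart_dom b p ->
    derivable ((b \o chart_inv a) : Cplx R -> Cplx R) (a p) 1.

Record riemannSurface (R : realType) := RiemannSurface {
  rs_space :> topologicalType;
  rs_atlas : set (chart R rs_space);
  rs_hausdorff : hausdorff_space rs_space;
  rs_nonempty : [set: rs_space] !=set0;
  rs_connected : connected [set: rs_space];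
  rs_cover : forall p, exists2 a, rs_atlas a & chart_dom a p;
  rs_compatible : forall a b, rs_atlas a -> rs_atlas b -> compatible a b
}.

Fixpoint Ck_on (R : realType) (V : normedModType R) (k : nat) (U : set V)
    (f : V -> R) : Prop :=
  (forall x, U x -> {for x, continuous f}) /\
  match k with
  | 0 => True
  | k'.+1 => forall v : V,
      (forall x, U x -> derivable f x v) /\ Ck_on k' U ('D_v f)
  end.

Definition smooth_on (R : realType) (V : normedModType R) (U : set V)
    (f : V -> R) := forall k, Ck_on k U f.

Definition mx_smooth_on (R : realType) (V : normedModType R) (m n : nat)
    (U : set V) (F : V -> 'M[Cplx R]_(m, n)) :=
  forall i j, smooth_on U (fun x => complex.Re (F x i j)) /\
              smooth_on U (fun x => complex.Im (F x i j)).

Definition iunit (R : realType) : Cplx R := 0 +i* 1.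

Definition of_xy (R : realType) (x : R * R) : Cplx R := x.1 +i* x.2.
Definition to_xy (R : realType) (z : Cplx R) : R * R :=
  (complex.Re z, complex.Im z).

Definition in_chart (R : realType) (M : topologicalType) (T : Type)
    (a : chart R M) (f : M -> T) : R * R -> T :=
  fun x => f (chart_inv a (of_xy x)).

Definition smooth_map (R : realType) (M : riemannSurface R) (m n : nat)
    (F : M -> 'M[Cplx R]_(m, n)) :=
  forall a, rs_atlas a ->
    mx_smooth_on [set x | (a @` chart_dom a) (of_xy x)] (in_chart a F).

Definition expi (R : realType) (t : R) : Cplx R := cos t +i* sin t.

(* Smoothness on S^1 x M, with S^1 parametrized by the angle. *)
Definition smooth_loop (R : realType) (M : riemannSurface R) (m n : nat)
    (Phi : Cplx R -> M -> 'M[Cplx R]_(m, n)) :=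
  forall a, rs_atlas a ->
    mx_smooth_on [set y : R * (R * R) | (a @` chart_dom a) (of_xy y.2)]
      (fun y => in_chart a (Phi (expi y.1)) y.2).

Definition dirder (R : realType) (v : R * R) (f : R * R -> Cplx R) (x : R * R)
    : Cplx R :=
  'D_v (fun y => complex.Re (f y)) x +i* 'D_v (fun y => complex.Im (f y)) x.

Definition dz (R : realType) (M : topologicalType) (a : chart R M) (m n : nat)
    (F : M -> 'M[Cplx R]_(m, n)) (p : M) : 'M[Cplx R]_(m, n) :=
  \matrix_(i, j)
    let f := in_chart a (fun q => F q i j) in let x := to_xy (a p) in
    ((dirder (1, 0) f x - iunit R * dirder (0, 1) f x) / 2 : Cplx R).

Definition dzbar (R : realType) (M : topologicalType) (a : chart R M)
    (m n : nat) (F : M -> 'M[Cplx R]_(m, n)) (p : M) : 'M[Cplx R]_(m, n) :=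
  \matrix_(i, j)
    let f := in_chart a (fun q => F q i j) in let x := to_xy (a p) in
    ((dirder (1, 0) f x + iunit R * dirder (0, 1) f x) / 2 : Cplx R).

Definition A_z (R : realType) (M : topologicalType) (a : chart R M) (n : nat)
    (F : M -> 'M[Cplx R]_n) (p : M) : 'M[Cplx R]_n :=
  2^-1 *: (invmx (F p) *m dz a F p).

Definition A_zbar (R : realType) (M : topologicalType) (a : chart R M)
    (n : nat) (F : M -> 'M[Cplx R]_n) (p : M) : 'M[Cplx R]_n :=
  2^-1 *: (invmx (F p) *m dzbar a F p).

Definition harmonic_map (R : realType) (M : riemannSurface R) (n : nat)
    (F : M -> 'M[Cplx R]_n) :=
  [/\ forall p, F p \is unitarymx,
      smooth_map F &
      forall a p, rs_atlas a -> chart_dom a p ->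
        dzbar a (A_z a F) p + dz a (A_zbar a F) p = 0].

Definition extended_solution (R : realType) (M : riemannSurface R) (n : nat)
    (F : M -> 'M[Cplx R]_n) (Phi : Cplx R -> M -> 'M[Cplx R]_n) :=
  [/\ forall l p, `|l| = 1 -> Phi l p \is unitarymx,
      smooth_loop Phi,
      forall p, Phi 1 p = 1%:M &
      forall l a p, `|l| = 1 -> rs_atlas a -> chart_dom a p ->
        invmx (Phi l p) *m dz a (Phi l) p = (1 - l^-1) *: A_z a F p /\
        invmx (Phi l p) *m dzbar a (Phi l) p = (1 - l) *: A_zbar a F p].

Definition finite_uniton_number (R : realType) (M : riemannSurface R)
    (n : nat) (F : M -> 'M[Cplx R]_n) :=
  exists2 Phi : Cplx R -> M -> 'M[Cplx R]_n, extended_solution F Phi &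
  exists r s : nat, exists2 C : int -> M -> 'M[Cplx R]_n,
    forall k, smooth_map (C k) &
    forall l p, `|l| = 1 ->
      Phi l p = \sum_(i < (r + s).+1)
                  l ^ (i%:Z - r%:Z) *: C (i%:Z - r%:Z) p.

Notation Csubspace R n := {vspace 'cV[Cplx R]_n}.

(* proj_ortho acts on row vectors, hence the transpositions. *)
Definition hproj (R : realType) (n : nat) (al : Csubspace R n) : 'M[Cplx R]_n :=
  (proj_ortho (\matrix_(i < \dim al) ((vbasis al)`_i)^T : 'M[Cplx R]_(_, n)))^T.

Definition perp (R : realType) (n : nat) (al : Csubspace R n) : Csubspace R n :=
  lker (linfun (mulmx (hproj al) : 'cV[Cplx R]_n -> 'cV[Cplx R]_n)).

Definition orthogonal_sub (R : realType) (n : nat) (al be : Csubspace R n) :=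
  forall u v : 'cV[Cplx R]_n, u \in al -> v \in be -> u ^t* *m v = 0.

Definition cartan (R : realType) (n : nat) (al : Csubspace R n) : 'M[Cplx R]_n :=
  hproj al - hproj (perp al).

Lemma herm_mul0 (C : numClosedFieldType) (n : nat) (A B : 'M[C]_n) :
  A ^t* = A -> B ^t* = B -> A *m B = 0 -> B *m A = 0.
Proof.
move=> hA hB /(congr1 (fun X : 'M[C]_n => X ^t*)) /=.
by rewrite trmx_mul map_mxM hA hB trmx0 map_mx0.
Qed.

Section HermitianProjection.
Variables (R : realType) (n : nat).
Implicit Types (al be : Csubspace R n) (v : 'cV[Cplx R]_n).

Let rows al : 'M[Cplx R]_(\dim al, n) :=
  \matrix_(i < \dim al) ((vbasis al)`_i)^T.

Let rowsP al v : (v \in al) = (v^T <= rows al)%MS.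
Proof.
apply/idP/submxP => [|[D hD]].
  move=> /coord_vbasis ->.
  exists (\row_i coord (vbasis al) i v).
  rewrite mulmx_sum_row raddf_sum; apply: eq_bigr => i _ /=.
  by rewrite rowK mxE linearZ.
have -> : v = \sum_i D 0 i *: (vbasis al)`_i.
  apply: trmx_inj; rewrite hD mulmx_sum_row raddf_sum; apply: eq_bigr => i _ /=.
  by rewrite rowK linearZ.
apply: rpred_sum => i _; apply: rpredZ; apply: vbasis_mem.
by rewrite mem_nth // size_tuple.
Qed.

Lemma hproj_id al v : (v \in al) = (hproj al *m v == v).
Proof.
rewrite rowsP; apply/idP/eqP => [h|h].
  by apply: trmx_inj; rewrite trmx_mul trmxK proj_ortho_id.
by rewrite -h trmx_mul trmxK proj_ortho_sub.
Qed.

Lemma hproj_mem al v : hproj al *m v \in al.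
Proof. by rewrite rowsP trmx_mul trmxK proj_ortho_sub. Qed.

Lemma hproj_idem al : hproj al *m hproj al = hproj al.
Proof. by rewrite -trmx_mul proj_ortho_proj. Qed.

Lemma hproj_herm al : (hproj al : 'M[Cplx R]_n) ^t* = hproj al.
Proof.
rewrite /hproj -/(rows al); set P := proj_ortho (rows al).
have /orthomx1P PQ : (P <= orthomx Num.Def.conjC (hermitian1mx n) (1%:M - P))%MS.
  rewrite orthomx_sym.
  have := proj_ortho_compl_sub (rows al) (1%:M : 'M[Cplx R]_n).
  by rewrite mul1mx -/P => /submx_trans; apply; rewrite submx_ortho proj_orthoE.
have PP : P = P *m P ^t*.
  move: PQ; rewrite [in _ ^t*]linearB /= map_mxB mulmxBr trmx1 map_mx1 mulmx1.
  by move/eqP; rewrite subr_eq0 => /eqP.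
have Ph : P ^t* = P by rewrite [in LHS]PP trmx_mul map_mxM trmxCK -PP.
by rewrite -[X in _ = X^T]Ph !map_trmx !trmxK.
Qed.

Lemma perpP al v :
  reflect (forall u : 'cV[Cplx R]_n, u \in al -> u ^t* *m v = 0)
          (v \in perp al).
Proof.
rewrite memv_ker lfunE /=; apply: (iffP eqP) => [h u|h].
  rewrite hproj_id => /eqP <-.
  by rewrite trmx_mul map_mxM hproj_herm -mulmxA h mulmx0.
apply/eqP; rewrite -(trmxCK (hproj al *m v)).
set w := hproj al *m v.
have : w ^t* *m w = 0.
  by rewrite /w trmx_mul map_mxM hproj_herm -mulmxA (mulmxA (hproj al)) hproj_idem
     mulmxA -[X in _ *m X *m _]hproj_herm -map_mxM -trmx_mul h ?hproj_mem.
move=> ww; rewrite trmxCK.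
have : dotmx (w ^t*) (w ^t*) == 0 by rewrite dotmxE trmxCK ww mxE.
by rewrite dnorm_eq0 => /eqP h0; rewrite -(trmxCK w) h0 linear0 map_mx0.
Qed.

Lemma hproj_perp al : hproj (perp al) = 1%:M - hproj al.
Proof.
have kk v : hproj al *m (hproj (perp al) *m v) = 0.
  by have := hproj_mem (perp al) v; rewrite memv_ker lfunE /= => /eqP.
have h1 : hproj al *m hproj (perp al) = 0.
  by apply/matrixP => i j; have /colP/(_ i) := kk (delta_mx j 0);
     rewrite mulmxA -colE !mxE.
have h2 : hproj (perp al) *m (1%:M - hproj al) = 1%:M - hproj al.
  apply/matrixP => i j.
  have : (1%:M - hproj al) *m delta_mx j 0 \in perp al.
    by rewrite memv_ker lfunE /= mulmxA mulmxBr mulmx1 hproj_idem subrr mul0mx.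
  rewrite hproj_id => /eqP; move: (hproj _) (1%:M - _) => P Q.
  by rewrite mulmxA -!colE => /colP/(_ i); rewrite !mxE.
have h3 : hproj (perp al) *m hproj al = 0.
  by apply: herm_mul0 h1; exact: hproj_herm.
by rewrite -h2 mulmxBr mulmx1 h3 subr0.
Qed.

End HermitianProjection.

Definition subbundle (R : realType) (M : riemannSurface R) (n r : nat)
    (phi : M -> Csubspace R n) :=
  (forall p, \dim (phi p) = r) /\ smooth_map (fun p => hproj (phi p)).

(* A'_{phi,psi} at p, as the endomorphism of C^n that vanishes on the orthogonal
   complement of phi p: a vector v of phi p is sent to
   pi_psi (d/dz (q |-> pi_phi(q) v)) p; see sff_section. *)
Definition sff (R : realType) (M : topologicalType) (a : chart R M) (n : nat)
    (phi psi : M -> Csubspace R n) (p : M) : 'M[Cplx R]_n :=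
  hproj (psi p) *m dz a (fun q => hproj (phi q)) p *m hproj (phi p).

Definition sff_perp (R : realType) (M : topologicalType) (a : chart R M)
    (n : nat) (phi : M -> Csubspace R n) : M -> 'M[Cplx R]_n :=
  sff a phi (fun q => perp (phi q)).

Section SecondFundamentalForm.
Variables (R : realType) (M : riemannSurface R) (a : chart R M).

Let cderivable (v : R * R) (f : R * R -> Cplx R) x :=
  derivable (fun y => complex.Re (f y)) x v /\
  derivable (fun y => complex.Im (f y)) x v.

Let dirderM v f g x : cderivable v f x -> cderivable v g x ->
  cderivable v (fun y => f y * g y) x /\
  dirder v (fun y => f y * g y) x = dirder v f x * g x + f x * dirder v g x.
Proof.
move=> [fr fi] [gr gi]; rewrite /cderivable /dirder.
have -> : (fun y => complex.Re (f y * g y)) =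
    (fun y => complex.Re (f y)) * (fun y => complex.Re (g y)) -
    (fun y => complex.Im (f y)) * (fun y => complex.Im (g y)).
  by apply/funext => y; rewrite !fctE; case: (f y) (g y) => ? ? [].
have -> : (fun y => complex.Im (f y * g y)) =
    (fun y => complex.Re (f y)) * (fun y => complex.Im (g y)) +
    (fun y => complex.Im (f y)) * (fun y => complex.Re (g y)).
  by apply/funext => y; rewrite !fctE; case: (f y) (g y) => ? ? [].
have [RR II] := (derivableM fr gr, derivableM fi gi).
have [RI IR] := (derivableM fr gi, derivableM fi gr).
split; first by split; [exact: derivableB RR II|exact: derivableD RI IR].
rewrite (deriveB RR II) (deriveD RI IR).
rewrite (deriveM fr gr) (deriveM fi gi) (deriveM fr gi) (deriveM fi gr).
move: (derive _ _ _) (derive _ _ _) (derive _ _ _) (derive _ _ _).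
case: (f x) (g x) => fx fy [gx gy] /= d1 d2 d3 d4.
by apply/eqP; rewrite eq_complex /= -![_ *: _]/(_ * _); apply/andP; split; apply/eqP; ring.
Qed.

Let dirder_sum v (I : Type) (r : seq I) (f : I -> R * R -> Cplx R) x :
  (forall i, cderivable v (f i) x) ->
  dirder v (fun y => \sum_(i <- r) f i y) x = \sum_(i <- r) dirder v (f i) x.
Proof.
move=> h; pose re i y := complex.Re (f i y); pose im i y := complex.Im (f i y).
have [hr hi] : (forall y, complex.Re (\sum_(i <- r) f i y) = \sum_(i <- r) re i y)
    /\ (forall y, complex.Im (\sum_(i <- r) f i y) = \sum_(i <- r) im i y).
  split=> y; elim: r => [|i r IH]; rewrite ?big_nil // !big_cons -IH /re /im;
    by case: (f i y) (\sum_(j <- r) f j y) => ? ? [].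
suff [_ [_ ->]] : derivable (fun y => \sum_(i <- r) re i y) x v /\
    derivable (fun y => \sum_(i <- r) im i y) x v /\
    dirder v (fun y => \sum_(i <- r) f i y) x = \sum_(i <- r) dirder v (f i) x.
  by [].
rewrite /dirder (funext hr) (funext hi).
elim: r {hr hi} => [|i r [IHr [IHi IH]]].
  have z : (fun y : R * R => \sum_(i <- [::]) re i y) = cst 0.
    by apply/funext => y; rewrite big_nil.
  have z' : (fun y : R * R => \sum_(i <- [::]) im i y) = cst 0.
    by apply/funext => y; rewrite big_nil.
  by rewrite z z' !derive_cst big_nil.
have e (g : I -> R * R -> R) : (fun y => \sum_(j <- i :: r) g j y) =
    g i + (fun y => \sum_(j <- r) g j y).
  by apply/funext => y; rewrite big_cons.
have [fr fi] := h i.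
rewrite !e (deriveD fr IHr) (deriveD fi IHi) big_cons -IH.
have [dr di] := (derivableD fr IHr, derivableD fi IHi).
split; [exact: dr|split; [exact: di|reflexivity]].
Qed.

Let smooth_cderivable m n (F : M -> 'M[Cplx R]_(m, n)) p v i j :
  smooth_map F -> rs_atlas a -> chart_dom a p ->
  cderivable v (in_chart a (fun q => F q i j)) (to_xy (a p)).
Proof.
move=> sF aa ap; have [sr si] := sF a aa i j.
have xy : [set x | (a @` chart_dom a) (of_xy x)] (to_xy (a p)).
  by exists p => //; rewrite /of_xy /to_xy /=; case: (a p).
by split; [case: (sr 1%N) => _ /(_ v)[+ _]|case: (si 1%N) => _ /(_ v)[+ _]];
  apply.
Qed.

Lemma dzM m n k (F : M -> 'M[Cplx R]_(m, n)) (G : M -> 'M[Cplx R]_(n, k)) p :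
  smooth_map F -> smooth_map G -> rs_atlas a -> chart_dom a p ->
  dz a (fun q => F q *m G q) p = dz a F p *m G p + F p *m dz a G p.
Proof.
move=> sF sG aa ap; apply/matrixP => i j; rewrite !mxE /=.
have pE : chart_inv a (of_xy (to_xy (a p))) = p.
  by rewrite -[RHS](chart_mapK ap) /of_xy /to_xy; case: (a p).
set x := to_xy _.
have DE v : dirder v (in_chart a (fun q => (F q *m G q) i j)) x =
    \sum_l (dirder v (in_chart a (fun q => F q i l)) x * G p l j +
            F p i l * dirder v (in_chart a (fun q => G q l j)) x).
  have -> : in_chart a (fun q => (F q *m G q) i j) =
      fun y => \sum_l (in_chart a (fun q => F q i l) y *
                       in_chart a (fun q => G q l j) y).
    by apply/funext => y; rewrite /in_chart mxE.
  have h l := dirderM (smooth_cderivable v i l sF aa ap)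
                      (smooth_cderivable v l j sG aa ap).
  rewrite dirder_sum; last by move=> l; case: (h l).
  by apply: eq_bigr => l _; have [_ ->] := h l; rewrite /in_chart pE.
rewrite !DE mulr_sumr -sumrB mulr_suml -big_split /=.
apply: eq_bigr => l _; rewrite !mxE /= -/x.
move: (dirder _ _ _) (dirder _ _ _) (dirder _ _ _) (dirder _ _ _) => u v w z.
by move: (F p i l : Cplx R) (G p l j : Cplx R) => f g; ring.
Qed.

Lemma sff_section n (phi psi : M -> Csubspace R n) (s : M -> 'cV[Cplx R]_n) p :
  smooth_map (fun q => hproj (phi q)) -> smooth_map s ->
  (forall q, s q \in phi q) -> orthogonal_sub (phi p) (psi p) ->
  rs_atlas a -> chart_dom a p ->
  sff a phi psi p *m s p = hproj (psi p) *m dz a s p.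
Proof.
move=> sphi ss sE op aa ap.
have Ps q : hproj (phi q) *m s q = s q by apply/eqP; rewrite -hproj_id.
have QP : hproj (psi p) *m hproj (phi p) = 0.
  have : hproj (phi p) *m hproj (psi p) = 0.
    apply/matrixP => i j.
    have : hproj (psi p) *m delta_mx j 0 \in perp (phi p).
      by apply/perpP => u uphi; apply: op => //; exact: hproj_mem.
    rewrite memv_ker lfunE /= mulmxA -colE => /eqP/colP/(_ i).
    by rewrite !mxE.
  by apply: herm_mul0; exact: hproj_herm.
have : dz a s p = dz a (fun q => hproj (phi q) *m s q) p.
  by congr (dz a _ p); apply/funext => q; rewrite Ps.
rewrite dzM // => ->; rewrite /sff.
move: (dz a s p) (dz a _ p) QP (Ps p) => d D.
move: (hproj (phi p)) (hproj (psi p)) (s p) => P Q w QP Pw.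
by rewrite mulmxDr (mulmxA Q P) QP mul0mx addr0 -!mulmxA Pw.
Qed.

End SecondFundamentalForm.

(* p^' is the filter of punctured neighbourhoods: psi is the image of A'_phi
   except possibly at isolated points. *)
Definition is_gauss (R : realType) (M : riemannSurface R) (n : nat)
    (phi psi : M -> Csubspace R n) :=
  (exists r, subbundle r psi) /\
  forall a p, rs_atlas a -> chart_dom a p ->
    \forall q \near p^',
      psi q = (linfun (mulmx (sff_perp a phi q) :
                 'cV[Cplx R]_n -> 'cV[Cplx R]_n) @: phi q)%VS.

(* There is at most one psi with is_gauss phi psi, and there is one whenever phi
   is harmonic; the zero bundle is a dummy value for the other phi. *)
Definition gauss (R : realType) (M : riemannSurface R) (n : nat)
    (phi : M -> Csubspace R n) : M -> Csubspace R n :=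
  xget (fun=> 0%VS) [set psi | is_gauss phi psi].

Definition gauss_iter (R : realType) (M : riemannSurface R) (n i : nat)
    (phi : M -> Csubspace R n) : M -> Csubspace R n :=
  iter i (@gauss R M n) phi.

Definition isotropic_upto (R : realType) (M : riemannSurface R) (n : nat)
    (phi : M -> Csubspace R n) (t : nat) :=
  forall i p, (1 <= i <= t)%N -> orthogonal_sub (phi p) (gauss_iter i phi p).

Definition strongly_isotropic (R : realType) (M : riemannSurface R) (n : nat)
    (phi : M -> Csubspace R n) :=
  forall i p, (1 <= i)%N -> orthogonal_sub (phi p) (gauss_iter i phi p).

Definition finite_isotropy_order (R : realType) (M : riemannSurface R)
    (n : nat) (phi : M -> Csubspace R n) (t : nat) :=
  [/\ (1 <= t)%N, isotropic_upto phi t &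
      forall t', isotropic_upto phi t' -> (t' <= t)%N].

Fixpoint sff_chain (R : realType) (M : riemannSurface R) (a : chart R M)
    (n : nat) (phi : M -> Csubspace R n) (t : nat) (p : M) : 'M[Cplx R]_n :=
  match t with
  | 0 => sff_perp a phi p
  | t'.+1 => sff_perp a (gauss_iter t phi) p *m sff_chain a phi t' p
  end.

Definition first_return (R : realType) (M : riemannSurface R) (a : chart R M)
    (n : nat) (phi : M -> Csubspace R n) (t : nat) (p : M) : 'M[Cplx R]_n :=
  hproj (phi p) *m sff_chain a phi t p.

(* The endomorphism c of the bundle phi is given in each chart a by matrices
   c a p, of which only the restriction to phi p matters. *)
Definition nilpotent_on (R : realType) (M : riemannSurface R) (n : nat)
    (phi : M -> Csubspace R n) (c : chart R M -> M -> 'M[Cplx R]_n) :=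
  exists j : nat, forall a p (v : 'cV[Cplx R]_n),
    rs_atlas a -> chart_dom a p -> v \in phi p -> (c a p ^+ j) *m v = 0.

(* Main.v *)
Require Import Defs.
From mathcomp Require Import all_boot all_order all_algebra.
From mathcomp Require Import complex.
From mathcomp Require Import all_classical all_reals all_analysis.
From mathcomp Require Import ring zify.

Set Implicit Arguments.
Unset Strict Implicit.
Unset Printing Implicit Defensive.

Import Order.TTheory GRing.Theory Num.Theory.
Import numFieldNormedType.Exports.

Local Open Scope classical_set_scope.
Local Open Scope ring_scope.

(** Write l for the spectral parameter, P for the projection onto phi and
    A = A_z. Conjugating d/dz by the extended solution Phi turns it into the
    connection D_l = d/dz + (1 - l^-1) A, so that for every N
      D_l^N P = Phi^* (d/dz)^N (Phi P)   on the circle |l| = 1.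
    If Phi is a trigonometric polynomial with exponents between - r and s, the
    right-hand side has exponents at least - (r + s), whatever N is: the order
    of the pole of D_l^N P at l = 0 is bounded independently of N.

    On the other hand D_l preserves phi and its orthogonal complement up to
    terms in l^-1, which exchange the two: each passage from one to the other
    costs one factor l^-1. Suppose phi is orthogonal to G^(1), ..., G^(t).
    A section of phi enters G^(1) with one factor l^-1, is then moved by
    derivatives through G^(1), ..., G^(t), all of them in the complement of
    phi, and cannot come back to phi before step t + 1, where the second factor
    l^-1 appears. What has come back by then is the first return map. Hence
    t + 1 steps raise the order of the pole by at most 2 and act on the leading
    coefficient as c(phi), so the coefficient of l^(- 2 j) in
    D_l^(j (t + 1)) P is c(phi)^j P. It vanishes as soon as 2 j > r + s.

    Two facts about the Gauss bundles enter: G^(i+1) contains the image of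
    A'_(G^(i)) at every point, by continuity from the punctured neighbourhoods
    where it is the image, and phi is orthogonal to G^(1), ..., G^(t). If at
    some stage there is no Gauss bundle, its dummy value is the zero bundle and
    so are all the following ones; phi is orthogonal to these, so this stage
    lies beyond t + 1 as soon as phi fails to be orthogonal to G^(t+1).

    The computation takes place in a ring with a derivation: [pole_coef_power]
    is the statement on leading coefficients, [iter_der_gauge] identifies the
    coefficients with those of D_l^N P, and [laurent_coef_eq0] compares the
    two sides on the circle. The ring is that of matrix-valued functions in a
    chart, [der_restr_derivation]; [punctured_zero] is the continuity argument
    behind [is_gauss_sff] and [is_gauss_orthogonal]. *)

(** * Rings with a derivation *)

(** The derivation is only required on a subring without unit: smooth functions
    on an open set, extended by zero, form such a subring of all functions. *)
Record derivation_on (K : pzRingType) (S : K -> Prop) (d : K -> K) : Prop := {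
  der_S0 : S 0;
  der_SD : forall f g, S f -> S g -> S (f + g);
  der_SN : forall f, S f -> S (- f);
  der_SM : forall f g, S f -> S g -> S (f * g);
  der_Sd : forall f, S f -> S (d f);
  der_D : forall f g, S f -> S g -> d (f + g) = d f + d g;
  der_M : forall f g, S f -> S g -> d (f * g) = d f * g + f * d g
}.

Section Derivation.
Variables (K : pzRingType) (S : K -> Prop) (d : K -> K).
Hypothesis dS : derivation_on S d.

Let S0 := der_S0 dS.
Let SD := der_SD dS.
Let SN := der_SN dS.
Let SM := der_SM dS.
Let Sd := der_Sd dS.
Let dD := der_D dS.
Let dM := der_M dS.

Lemma der_SB f g : S f -> S g -> S (f - g).
Proof. by move=> Sf Sg; apply: SD => //; apply: SN. Qed.

Lemma der_0 : d 0 = 0.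
Proof. by apply: (addrI (d 0)); rewrite -dD // !addr0. Qed.

(** The second fundamental form of the subbundle onto which P projects. *)
Definition second_form (P : K) : K := d P * P - P * d P * P.

Lemma second_formS P : S P -> S (second_form P).
Proof. by move=> SP; apply: der_SB; do ?apply: SM => //; apply: Sd. Qed.

(** Differentiating P P = P and multiplying by P cancels the other term: the
    derivative of a projection exchanges the image and the kernel. *)
Lemma idem_der_idem P : S P -> P * P = P -> P * d P * P = 0.
Proof.
move=> SP PP; have := congr1 ( *%R P) (dM SP SP).
by rewrite PP mulrDr !mulrA PP => /eqP; rewrite eq_sym -subr_eq0 addrK => /eqP.
Qed.

Lemma second_formE P : S P -> P * P = P -> second_form P = d P * P.
Proof. by move=> SP PP; rewrite /second_form idem_der_idem // subr0. Qed.

Lemma der_section P Y : S P -> P * P = P -> S Y -> P * Y = Y ->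
  d Y = P * d Y + second_form P * Y.
Proof.
move=> SP PP SY PY.
by rewrite -{1}PY dM // second_formE // -mulrA PY addrC.
Qed.

Lemma idem_second_form P : S P -> P * P = P -> P * second_form P = 0.
Proof. by move=> SP PP; rewrite second_formE // mulrA idem_der_idem. Qed.

Definition der_const (x : K) := [/\ forall f, f * x = x * f,
  forall f, S f -> S (x * f) & forall f, S f -> d (x * f) = x * d f].

Lemma der_S_sum (I : Type) (s : seq I) (F : I -> K) :
  (forall i, S (F i)) -> S (\sum_(i <- s) F i).
Proof. by move=> SF; elim/big_ind: _ => // f g; exact: SD. Qed.

Lemma der_sum (I : Type) (s : seq I) (F : I -> K) :
  (forall i, S (F i)) -> d (\sum_(i <- s) F i) = \sum_(i <- s) d (F i).
Proof.
move=> SF; elim: s => [|i s IH]; first by rewrite !big_nil der_0.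
by rewrite !big_cons dD ?IH //; exact: der_S_sum.
Qed.

Lemma iter_derS N f : S f -> S (iter N d f).
Proof. by move=> Sf; elim: N => //= N; exact: Sd. Qed.

Lemma iter_der_const_sum N (I : Type) (s : seq I) (y f : I -> K) :
  (forall i, der_const (y i)) -> (forall i, S (f i)) ->
  iter N d (\sum_(i <- s) y i * f i) = \sum_(i <- s) y i * iter N d (f i).
Proof.
move=> yc Sf; elim: N => //= N ->; rewrite der_sum => [|i].
  by apply: eq_bigr => i _; have [_ _ ->] := yc i; rewrite //; exact: iter_derS.
by have [_ + _] := yc i; apply; exact: iter_derS.
Qed.

Section Grading.
Variable P : K.
Hypotheses (SP : S P) (PP : P * P = P).

(** In the expansion of D_l^N P in powers of l^-1 the even coefficients are
    sections of phi and the odd ones sections of its complement, because each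
    factor l^-1 goes with a passage between the two. *)
Definition parity_part (m : nat) (f : K) := if odd m then f - P * f else P * f.

Lemma parity_partS m f : S f -> S (parity_part m f).
Proof.
by rewrite /parity_part => Sf; case: ifP => _; [apply: der_SB => //|]; apply: SM.
Qed.

Lemma parity_part0 m : parity_part m 0 = 0.
Proof. by rewrite /parity_part mulr0 subr0; case: ifP. Qed.

Lemma parity_partD m f g : parity_part m (f + g) = parity_part m f + parity_part m g.
Proof. by rewrite /parity_part; case: (odd m); rewrite /= mulrDr // opprD addrACA. Qed.

Lemma parity_part_idem m f : parity_part m (parity_part m f) = parity_part m f.
Proof.
by rewrite /parity_part; case: (odd m); rewrite /= ?mulrBr !mulrA PP // subrr subr0.
Qed.

(** The coefficient of l^-m in D_l^N P. The parity of m already selects the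
    component: the connection part of D_l acts on the coefficient of l^-m, the
    off-diagonal part on that of l^-(m-1), and both act as the derivative
    followed by the projection belonging to m. *)
Fixpoint pole_coef (N : nat) : nat -> K :=
  if N is N'.+1 then fun m =>
    parity_part m (d (pole_coef N' m + (if m is m'.+1 then pole_coef N' m' else 0)))
  else fun m => if m is 0%N then P else 0.

Lemma pole_coefS N m : S (pole_coef N m).
Proof.
elim: N m => [|N IH] m /=; first by case: m.
by apply: parity_partS; apply: Sd; apply: SD => //; case: m.
Qed.
Hint Resolve pole_coefS : core.

Lemma pole_coef_parity N m : parity_part m (pole_coef N m) = pole_coef N m.
Proof.
case: N => [|N] /=; last exact: parity_part_idem.
by case: m => [|m]; rewrite ?parity_part0 // /parity_part /= PP.
Qed.

Lemma pole_coef_gt N m : (N < m)%N -> pole_coef N m = 0.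
Proof.
elim: N m => [|N IH] [|m] //= Nm.
by rewrite !IH ?addr0 ?der_0 ?parity_part0 //; exact: ltnW.
Qed.

Lemma pole_coefSS N m : pole_coef N.+1 m.+1 =
  parity_part m.+1 (d (pole_coef N m.+1) + d (pole_coef N m)).
Proof. by rewrite /= dD. Qed.

Lemma pole_coefS0 N : pole_coef N.+1 0 = parity_part 0 (d (pole_coef N 0)).
Proof. by rewrite /= addr0. Qed.

Arguments pole_coef : simpl never.

Lemma parity_der_even m f : odd m -> S f -> P * f = f ->
  parity_part m (d f) = second_form P * f.
Proof.
move=> om Sf Pf; rewrite /parity_part om.
rewrite {1}(der_section SP PP Sf Pf) {2}(der_section SP PP Sf Pf).
by rewrite mulrDr !mulrA PP idem_second_form // mul0r addr0 addrC addKr.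
Qed.

(** Here x stands for l^-1, and A is A_z for the map 2 P - 1 into the unitary
    group. *)
Section Gauge.
Variables (x Phi : K).
Hypothesis x_const : der_const x.
Let A := P * d P *+ 2 - d P.
Hypothesis SPhi : S Phi.
Hypothesis dPhi : d Phi = Phi * (A - x * A).

Let D f := d f + (A - x * A) * f.

(** On a section of the image or of the kernel of P, A is minus the
    off-diagonal part of the derivative. *)
Let D_coef N m : D (pole_coef N m) =
  parity_part m (d (pole_coef N m)) + x * parity_part m.+1 (d (pole_coef N m)).
Proof.
suff e : A * pole_coef N m = - parity_part m.+1 (d (pole_coef N m)).
  rewrite /D mulrBl -mulrA e mulrN opprK addrA; congr (_ + _).
  by rewrite /parity_part /=; case: (odd m); rewrite //= subKr.
have := pole_coef_parity N m; move: (pole_coefS N m); move: (pole_coef N m) => f Sf.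
rewrite /parity_part /=; case: (odd m) => /= fP.
  have P0f : P * f = 0.
    by rewrite -fP mulrBr mulrA PP subrr.
  have e : d P * f = - (P * d f).
    by apply/eqP; rewrite -subr_eq0 opprK -dM // P0f der_0.
  rewrite /A mulrBl mulrnAl -mulrA e mulrN mulrA PP opprK mulNrn mulr2n.
  by rewrite opprD subrK.
have e : P * d P * f = 0.
  by rewrite -fP mulrA idem_der_idem // mul0r.
rewrite /A mulrBl mulrnAl e mul0rn sub0r; congr (- _).
have := der_section SP PP Sf fP; rewrite second_formE // -mulrA fP => df.
by rewrite {1}df addrC addKr.
Qed.

Let xC f : f * x = x * f.
Proof. by case: x_const. Qed.

Let Sx f : S f -> S (x * f).
Proof. by case: x_const => _ + _; apply. Qed.

Let dx f : S f -> d (x * f) = x * d f.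
Proof. by case: x_const => _ _; apply. Qed.

Let SxX m f : S f -> S (x ^+ m * f).
Proof.
by move=> Sf; elim: m => [|m IH]; rewrite ?mul1r // exprS -mulrA; exact: Sx.
Qed.

Let xXC m f : f * x ^+ m = x ^+ m * f.
Proof. by elim: m => [|m IH]; rewrite ?mulr1 ?mul1r // exprS mulrA xC -!mulrA IH. Qed.

Let D_xX m f : S f -> D (x ^+ m * f) = x ^+ m * D f.
Proof.
move=> Sf; rewrite /D [RHS]mulrDr; congr (_ + _); last by rewrite !mulrA xXC.
elim: m => [|m IH]; rewrite ?mul1r // exprS -!mulrA dx ?IH //.
exact: SxX.
Qed.

Let D_sum n (F : nat -> K) : (forall i, S (F i)) ->
  D (\sum_(i < n) F i) = \sum_(i < n) D (F i).
Proof. by move=> SF; rewrite /D der_sum // mulr_sumr -big_split. Qed.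

Let D_gen N : D (\sum_(m < N.+1) x ^+ m * pole_coef N m) =
  \sum_(m < N.+2) x ^+ m * pole_coef N.+1 m.
Proof.
rewrite (D_sum _ (F := fun m => x ^+ m * pole_coef N m)); last first.
  by move=> m; exact: SxX.
under eq_bigr => m _ do rewrite D_xX // D_coef mulrDr mulrA -exprSr.
rewrite big_split /= [RHS]big_ord_recl.
have -> : \sum_(i < N.+1) x ^+ bump 0 i * pole_coef N.+1 (bump 0 i) =
    \sum_(i < N.+1) x ^+ i.+1 * parity_part i.+1 (d (pole_coef N i.+1)) +
    \sum_(i < N.+1) x ^+ i.+1 * parity_part i.+1 (d (pole_coef N i)).
  rewrite -big_split /=; apply: eq_bigr => i _.
  by rewrite /bump add1n pole_coefSS parity_partD mulrDr.
rewrite addrA; congr (_ + _); rewrite big_ord_recl pole_coefS0; congr (_ + _).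
by rewrite [RHS]big_ord_recr /= pole_coef_gt // der_0 parity_part0 mulr0 addr0.
Qed.

(** Phi intertwines D_l with the derivation: d (Phi f) = Phi (D_l f). *)
Lemma iter_der_gauge N :
  iter N d (Phi * P) = Phi * \sum_(m < N.+1) x ^+ m * pole_coef N m.
Proof.
elim: N => [|N IH]; first by rewrite big_ord1 mul1r.
have SG : S (\sum_(m < N.+1) x ^+ m * pole_coef N m).
  by apply: der_S_sum => m; exact: SxX.
rewrite -D_gen iterS IH dM // dPhi /D [RHS]mulrDr addrC; congr (_ + _).
by rewrite mulrA.
Qed.

End Gauge.
End Grading.
Arguments pole_coef : simpl never.

(** P j is the projection onto G^(j); [PsffP] says that G^(j+1) contains the
    image of the second fundamental form of G^(j). *)
Section Return.
Variables (P : nat -> K) (t : nat).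
Hypothesis t_gt0 : (0 < t)%N.
Hypothesis SP : forall j, (j <= t)%N -> S (P j).
Hypothesis PP : forall j, (j <= t)%N -> P j * P j = P j.
Hypothesis P0P : forall j, (0 < j <= t)%N -> P 0%N * P j = 0.
Hypothesis PsffP : forall j, (j < t)%N ->
  P j.+1 * second_form (P j) = second_form (P j).

Local Notation X := (pole_coef (P 0%N)).

Fixpoint form_chain i :=
  if i is i'.+1 then second_form (P i) * form_chain i' else second_form (P 0%N).

Let SP0 : S (P 0%N) := SP (leq0n t).
Let PP0 : P 0%N * P 0%N = P 0%N := PP (leq0n t).
Let XS N m : S (X N m) := pole_coefS SP0 N m.
Let XSS N m : X N.+1 m.+1 = parity_part (P 0%N) m.+1 (d (X N m.+1) + d (X N m)) :=
  pole_coefSS SP0 N m.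
Hint Resolve XS : core.

Lemma form_chainS i : (i <= t)%N -> S (form_chain i).
Proof.
elim: i => [|i IH] it /=; first exact: second_formS.
by apply: SM; [apply: second_formS; apply: SP|apply: IH; exact: ltnW].
Qed.

Lemma form_chain_section i : (i < t)%N -> P i.+1 * form_chain i = form_chain i.
Proof. by case: i => [|i] it /=; rewrite ?mulrA PsffP. Qed.

(** The sections of the possibly non-direct sum G^(1) + ... + G^(i), encoded by
    the existence of a decomposition. *)
Fixpoint gauss_span i (f : K) : Prop :=
  if i is i'.+1 then exists g, exists h,
    [/\ gauss_span i' g, S h, P i * h = h & f = g + h]
  else f = 0.

Lemma gauss_spanS i f : gauss_span i f -> S f.
Proof.
elim: i f => [|i IH] f /=; first by move=> ->.
by move=> [g [h [/IH Sg Sh _ ->]]]; apply: SD.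
Qed.

Lemma gauss_span0 i : gauss_span i 0.
Proof. by elim: i => //= i IH; exists 0, 0; rewrite mulr0 addr0. Qed.

Lemma gauss_span_succ i f : gauss_span i f -> gauss_span i.+1 f.
Proof. by move=> sf; exists f, 0; rewrite mulr0 addr0. Qed.

Lemma gauss_spanD i f g : gauss_span i f -> gauss_span i g -> gauss_span i (f + g).
Proof.
elim: i f g => [|i IH] f g /=; first by move=> -> ->; rewrite addr0.
move=> [f1 [f2 [sf1 Sf2 Pf2 ->]]] [g1 [g2 [sg1 Sg2 Pg2 ->]]].
exists (f1 + g1), (f2 + g2); split; [exact: IH|exact: SD| |exact: addrACA].
by rewrite mulrDr Pf2 Pg2.
Qed.

Lemma section_gauss_span i f : S f -> P i.+1 * f = f -> gauss_span i.+1 f.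
Proof. by move=> Sf Pf; exists 0, f; split; rewrite ?add0r //; exact: gauss_span0. Qed.

Lemma section_gauss_span_le i j f : S f -> P i.+1 * f = f -> (i < j)%N -> gauss_span j f.
Proof.
move=> Sf Pf; elim: j => // j IH; rewrite ltnS leq_eqVlt => /predU1P[<-|ij].
  exact: section_gauss_span.
by apply: gauss_span_succ; exact: IH.
Qed.

Lemma gauss_span_orthogonal i f : (i <= t)%N -> gauss_span i f -> P 0%N * f = 0.
Proof.
elim: i f => [|i IH] f it /=; first by move=> ->; rewrite mulr0.
move=> [g [h [/(IH _ (ltnW it)) Pg _ Ph ->]]].
by rewrite mulrDr Pg add0r -Ph mulrA P0P // mul0r.
Qed.

Lemma der_section_split i f : (i < t)%N -> S f -> P i * f = f ->
  [/\ d f = P i * d f + second_form (P i) * f, S (P i * d f),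
      P i * (P i * d f) = P i * d f, S (second_form (P i) * f) &
      P i.+1 * (second_form (P i) * f) = second_form (P i) * f].
Proof.
move=> it Sf Pf; have iet := ltnW it; split.
- by apply: der_section => //; [exact: SP|exact: PP].
- by apply: SM; [exact: SP|exact: Sd].
- by rewrite mulrA PP.
- by apply: SM => //; apply: second_formS; exact: SP.
- by rewrite mulrA PsffP.
Qed.

(** A derivative moves a section of G^(j) by a section of G^(j) and one of
    G^(j+1). *)
Lemma gauss_span_der i f : (i < t)%N -> gauss_span i f -> gauss_span i.+1 (d f).
Proof.
elim: i f => [|i IH] f it; first by move=> /= ->; rewrite der_0; exact: (gauss_span0 1).
move=> [g [h [sg Sh Ph ->]]].
have [dh S1 P1 S2 P2] := der_section_split it Sh Ph.
have gS : gauss_span i.+1 (d g) by apply: IH => //; exact: ltnW.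
rewrite dD //; last exact: gauss_spanS sg.
rewrite dh addrA; exists (d g + P i.+1 * d h), (second_form (P i.+1) * h); split=> //.
by apply: gauss_spanD => //; exact: section_gauss_span.
Qed.

Lemma parity_gauss_span m i f : odd m -> (i <= t)%N -> gauss_span i f ->
  parity_part (P 0%N) m f = f.
Proof.
by rewrite /parity_part => -> it /(gauss_span_orthogonal it) ->; rewrite subr0.
Qed.

(** Step N is one where the leading pole m is even, so that the leading
    coefficient is a section of phi. *)
Section OneReturn.
Variables (N m : nat).
Hypothesis m_even : ~~ odd m.
Hypothesis top : forall k, (m < k)%N -> X N k = 0.

Let coef_even i : P 0%N * X i m = X i m.
Proof. by have := pole_coef_parity PP0 i m; rewrite /parity_part (negPf m_even). Qed.

Let chain_span i w : (i < t)%N -> gauss_span i w ->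
  gauss_span i.+1 (form_chain i * X N m + w).
Proof.
move=> it sw; rewrite addrC; exists w, (form_chain i * X N m); split=> //.
  by apply: SM => //; apply: form_chainS; exact: ltnW.
by rewrite mulrA form_chain_section.
Qed.

(** Before the first possible return, the pole has order m + 1 and the leading
    coefficient has advanced to G^(i+1), up to sections of the Gauss bundles
    already passed, which arise from the connection part and from what leaves
    phi at later steps. *)
Let below i : (i < t)%N ->
  (forall k, (m.+1 < k)%N -> X (i.+1 + N) k = 0) /\
  exists2 w, gauss_span i w & X (i.+1 + N) m.+1 = form_chain i * X N m + w.
Proof.
elim: i => [|i IH] it.
  split=> [[//|k] mk|].
    by rewrite add1n XSS !top ?der_0 ?addr0 ?parity_part0 //; lia.
  exists 0 => //; rewrite add1n XSS top // der_0 add0r addr0 /=.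
  by rewrite parity_der_even //=; rewrite m_even.
have [z [w sw e]] := IH (ltnW it).
have sX : gauss_span i.+1 (X (i.+1 + N) m.+1).
  by rewrite e; apply: chain_span => //; exact: ltnW.
split=> [[//|k] mk|].
  rewrite addSn XSS (z k.+1) // der_0 add0r.
  have [->|km] := eqVneq k m.+1; last by rewrite z ?der_0 ?parity_part0 //; lia.
  rewrite /parity_part /= (negPf m_even) /=.
  by apply: (@gauss_span_orthogonal i.+2) => //; apply: gauss_span_der.
have Sc : S (form_chain i * X N m).
  by apply: SM => //; apply: form_chainS; lia.
have [de S1 P1 S2 P2] : [/\ _, _, _, _ & _] := der_section_split it Sc
  (etrans (mulrA _ _ _) (congr1 (fun u => u * _) (form_chain_section (ltnW it)))).
(* The three terms: the connection part on the advancing section, what had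
   been left behind, and what leaves phi at this step. *)
exists (P i.+1 * d (form_chain i * X N m) + d w
        + second_form (P 0%N) * X (i.+1 + N) m).
  apply: gauss_spanD.
    apply: gauss_spanD; first exact: section_gauss_span.
    by apply: gauss_span_der => //; exact: ltnW.
  apply: (@section_gauss_span_le 0) => //; last by rewrite mulrA PsffP.
  by apply: SM => //; exact: second_formS.
rewrite addSn XSS parity_partD (parity_der_even SP0 PP0 _ (XS (i.+1 + N) m)) //.
rewrite (parity_gauss_span (i := i.+2)) //; last exact: gauss_span_der.
rewrite {1}e dD //; last exact: gauss_spanS sw.
by rewrite {1}de -mulrA addrA; congr (_ + _); rewrite -!addrA addrCA.
Qed.

(** At step t + 1 only the component in G^(t) can reach phi: derivatives of
    sections of G^(1), ..., G^(t-1) stay in G^(1) + ... + G^(t). *)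
Lemma pole_coef_return :
  (forall k, (m.+2 < k)%N -> X (t.+1 + N) k = 0) /\
  X (t.+1 + N) m.+2 = P 0%N * form_chain t * X N m.
Proof.
have [t' tE] : exists t', t = t'.+1 by case: t t_gt0 => // t' _; exists t'.
have t't : (t' < t)%N by rewrite tE.
have [z [w sw e]] := below t't.
split=> [[//|k] mk|].
  by rewrite tE addSn XSS !z ?der_0 ?addr0 ?parity_part0 //; lia.
have Sc : S (form_chain t' * X N m).
  by apply: SM => //; apply: form_chainS; exact: ltnW.
rewrite {1}tE addSn XSS z // der_0 add0r /parity_part /= (negPf m_even) /=.
rewrite e dD //; last exact: gauss_spanS sw.
rewrite mulrDr (gauss_span_orthogonal _ (gauss_span_der t't sw)) // addr0.
have Pc : P t * (form_chain t' * X N m) = form_chain t' * X N m.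
  by rewrite mulrA {1}tE form_chain_section.
rewrite (der_section (SP (leqnn t)) (PP (leqnn t)) Sc Pc) mulrDr mulrA P0P ?t_gt0 ?leqnn //.
have -> : form_chain t = second_form (P t) * form_chain t' by rewrite tE.
by rewrite mul0r add0r !mulrA.
Qed.

End OneReturn.

Lemma pole_coef_power j :
  (forall k, (j.*2 < k)%N -> X (j * t.+1) k = 0) /\
  X (j * t.+1) j.*2 = (P 0%N * form_chain t) ^+ j * P 0%N.
Proof.
elim: j => [|j [z e]]; first by split=> [[]|] //; rewrite /= mul1r.
have [z' e'] := pole_coef_return (negbT (odd_double j)) z.
by rewrite mulSn doubleS; split=> //; rewrite e' e exprS !mulrA.
Qed.

End Return.
End Derivation.

(** * Laurent polynomials on the unit circle *)

Section UnitCircle.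
Variable C : numClosedFieldType.

(** The Cayley transforms (1 + k i) / (1 - k i) of the natural numbers k are
    infinitely many points of the unit circle. *)
Lemma poly_circle_eq0 (p : {poly C}) : (forall l, `|l| = 1 -> p.[l] = 0) -> p = 0.
Proof.
move=> h; pose w (k : nat) : C := 1 + k%:R * 'i.
have wC k : (w k)^* = 1 - k%:R * 'i.
  by rewrite /w rmorphD rmorphM /= rmorph1 conjC_nat conjCi mulrN.
have ii : 'i * 'i = -1 :> C by rewrite -expr2 sqrCi.
have w0 k : w k != 0.
  apply/eqP => wk; have : w k * (w k)^* = (1 + k * k)%N%:R.
    rewrite wC /w natrD natrM.
    by rewrite mulrDl mul1r mulrBr mulr1 mulrACA ii; ring.
  by rewrite wk mul0r => /eqP; rewrite eq_sym pnatr_eq0.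
have wC0 k : (w k)^* != 0 by rewrite conjC_eq0.
pose z k := w k / (w k)^*.
have z1 k : `|z k| = 1 by rewrite /z normrM normfV norm_conjC divff // normr_eq0.
have zI : injective z.
  move=> k m /eqP; rewrite /z eqr_div // !wC /w => /eqP e.
  have : (k%:R - m%:R) * 2 * 'i = 0 :> C.
    have -> : (k%:R - m%:R) * 2 * 'i = (1 + k%:R * 'i) * (1 - m%:R * 'i) -
       (1 + m%:R * 'i) * (1 - k%:R * 'i) :> C by ring.
    by rewrite e subrr.
  move/eqP; rewrite !mulf_eq0 (negPf (neq0Ci C)) orbF pnatr_eq0 orbF subr_eq0 eqr_nat.
  by move/eqP.
apply: (@roots_geq_poly_eq0 _ p [seq z k | k <- iota 0 (size p)]).
- by apply/allP => _ /mapP[k _ ->]; apply/rootP; exact: h.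
- by rewrite map_inj_uniq ?iota_uniq.
- by rewrite size_map size_iota.
Qed.

(** The right-hand side has no exponent below - s. Multiplying by l^N turns both
    sides into polynomials. *)
Lemma laurent_coef_eq0 n s N (X : nat -> 'M[C]_n) (W : nat -> nat -> 'M[C]_n) :
  (s <= N)%N ->
  (forall l, `|l| = 1 -> \sum_(m < N.+1) (l^-1) ^+ m *: X m =
     \sum_(k < s.+1) \sum_(i < s.+1) (l ^+ i / l ^+ k) *: W k i) ->
  forall m, (s < m <= N)%N -> X m = 0.
Proof.
move=> sN XW m0 /andP[sm mN]; apply/matrixP => a b; rewrite mxE.
pose p : {poly C} := \sum_(m < N.+1) X m a b *: 'X^(N - m).
(* Since k <= s <= N the exponent N - k + i is at least N - s. *)
pose q : {poly C} := \sum_(k < s.+1) \sum_(i < s.+1) W k i a b *: 'X^(N - k + i).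
have pq : p - q = 0.
  apply: poly_circle_eq0 => l l1; have l0 : l != 0 by rewrite -normr_eq0 l1 oner_eq0.
  have shift k y : (k <= N)%N -> l ^+ N * (l^-1 ^+ k * y) = y * l ^+ (N - k).
    by move=> kN; rewrite -{1}(subnK kN) exprD exprVn mulrA mulfK ?expf_neq0 // mulrC.
  have := congr1 (fun A : 'M[C]_n => l ^+ N * A a b) (XW l l1).
  rewrite hornerD hornerN /p /q !horner_sum !summxE !mulr_sumr => e.
  apply/eqP; rewrite subr_eq0; apply/eqP; move: e.
  congr (_ = _); apply: eq_bigr => k _.
    by rewrite hornerZ hornerXn mxE shift // -ltnS.
  rewrite horner_sum summxE mulr_sumr; apply: eq_bigr => i _.
  rewrite hornerZ hornerXn mxE.
  have -> : l ^+ i / l ^+ k * W k i a b = l^-1 ^+ k * (l ^+ i * W k i a b).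
    by rewrite exprVn mulrA [_ / _]mulrC.
  by rewrite shift ?exprD; [ring|exact: leq_trans (leq_ord k) sN].
have qE : q`_(N - m0) = 0.
  rewrite /q !coef_sum big1 // => k _; rewrite coef_sum big1 // => i _.
  rewrite coefZ coefXn; case: eqP => [e|_]; last by rewrite mulr0.
  by have := ltn_ord k; lia.
have pE : p`_(N - m0) = X m0 a b.
  have m0N : (m0 < N.+1)%N by [].
  rewrite /p coef_sum (bigD1 (Ordinal m0N)) //= coefZ coefXn eqxx mulr1 big1 ?addr0 //.
  move=> m; rewrite -val_eqE /= => mm0; rewrite coefZ coefXn; case: eqP => [e|_].
    by have := ltn_ord m; lia.
  by rewrite mulr0.
rewrite -pE; have := congr1 (fun r : {poly C} => r`_(N - m0)) pq.
by rewrite coefB qE subr0 coef0.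
Qed.
End UnitCircle.

Local Open Scope complex_scope.
Local Open Scope sesquilinear_scope.

(** * Smooth functions and the Wirtinger derivative *)

Section Smooth.
Variables (R : realType) (V : normedModType R) (U : set V).
Hypothesis U_open : open U.
Implicit Types f g : V -> R.

Lemma near_eq_on (T : Type) (f g : V -> T) x : (forall y, U y -> f y = g y) -> U x ->
  \near x, f x = g x.
Proof.
by move=> fg Ux; apply: filterS fg _; apply: open_nbhs_nbhs.
Qed.

Lemma eq_Ck_on k f g : (forall x, U x -> f x = g x) -> Ck_on k U f -> Ck_on k U g.
Proof.
elim: k f g => [|k IH] f g fg [cf df]; split=> //.
- move=> x Ux; rewrite /prop_for /continuous_at -fg //.
  by apply: cvg_trans (cf x Ux); apply: near_eq_cvg; exact: near_eq_on.
- move=> x Ux; rewrite /prop_for /continuous_at -fg //.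
  by apply: cvg_trans (cf x Ux); apply: near_eq_cvg; exact: near_eq_on.
move=> v; have [dfv Cf] := df v; split.
  move=> x Ux; apply: near_eq_derivable (dfv x Ux); exact: near_eq_on.
apply: IH Cf => x Ux; apply: near_eq_derive; exact: near_eq_on.
Qed.

Lemma Ck_onW k f : Ck_on k.+1 U f -> Ck_on k U f.
Proof.
elim: k f => [|k IH] f [cf df]; split=> // v.
by have [dfv Cf] := df v; split=> //; exact: IH.
Qed.

Lemma Ck_on_cst k (c : R) : Ck_on k U (fun=> c).
Proof.
elim: k c => [|k IH] c; split=> //; try by move=> x _; exact: cst_continuous.
move=> v; split=> [x _|]; first exact: derivable_cst.
apply: eq_Ck_on (IH 0) => x Ux; exact/esym/derive_cst.
Qed.

Lemma Ck_onD k f g : Ck_on k U f -> Ck_on k U g -> Ck_on k U (f \+ g).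
Proof.
elim: k f g => [|k IH] f g [cf df] [cg dg]; split=> //;
  try by move=> x Ux; apply: cvgD; [exact: cf|exact: cg].
move=> v; have [dfv Cf] := df v; have [dgv Cg] := dg v.
split=> [x Ux|]; first exact: derivableD (dfv x Ux) (dgv x Ux).
apply: eq_Ck_on (IH _ _ Cf Cg) => x Ux.
exact/esym/(deriveD (dfv x Ux) (dgv x Ux)).
Qed.

Lemma Ck_onM k f g : Ck_on k U f -> Ck_on k U g -> Ck_on k U (f \* g).
Proof.
elim: k f g => [|k IH] f g Cf Cg; have [cf df] := Cf; have [cg dg] := Cg; split=> //;
  try by move=> x Ux; apply: cvgM; [exact: cf|exact: cg].
move=> v; have [dfv Cdf] := df v; have [dgv Cdg] := dg v.
split=> [x Ux|]; first exact: derivableM (dfv x Ux) (dgv x Ux).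
apply: eq_Ck_on (Ck_onD (IH _ _ (Ck_onW Cf) Cdg) (IH _ _ Cdf (Ck_onW Cg))) => x Ux.
rewrite (deriveM (dfv x Ux) (dgv x Ux)) /=; congr (_ + _); exact: mulrC.
Qed.

Lemma smooth_derivable f x v : smooth_on U f -> U x -> derivable f x v.
Proof. by move=> sf Ux; have [_ /(_ v)[dfv _]] := sf 1%N; exact: dfv. Qed.

Lemma smooth_derive f v : smooth_on U f -> smooth_on U ('D_v f).
Proof. by move=> sf k; have [_ /(_ v)[]] := sf k.+1. Qed.

Lemma smoothM f g : smooth_on U f -> smooth_on U g -> smooth_on U (f \* g).
Proof. by move=> sf sg k; exact: Ck_onM. Qed.

Lemma smoothD f g : smooth_on U f -> smooth_on U g -> smooth_on U (f \+ g).
Proof. by move=> sf sg k; exact: Ck_onD. Qed.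

Lemma eq_smooth f g : (forall x, U x -> f x = g x) -> smooth_on U f -> smooth_on U g.
Proof. by move=> fg sf k; exact: eq_Ck_on (sf k). Qed.

Definition csmooth (f : V -> Cplx R) :=
  smooth_on U (fun x => complex.Re (f x)) /\ smooth_on U (fun x => complex.Im (f x)).

Lemma eq_csmooth (f g : V -> Cplx R) :
  (forall x, U x -> f x = g x) -> csmooth f -> csmooth g.
Proof. by move=> fg [fr fi]; split; [move: fr|move: fi]; apply: eq_smooth => x /fg ->. Qed.

Lemma csmooth_cst (c : Cplx R) : csmooth (fun=> c).
Proof. by split=> k; exact: Ck_on_cst. Qed.

Lemma csmoothD (f g : V -> Cplx R) :
  csmooth f -> csmooth g -> csmooth (fun x => f x + g x).
Proof.
move=> [fr fi] [gr gi]; split.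
  by apply: eq_smooth (smoothD fr gr) => x _ /=; case: (f x) (g x) => ? ? [].
by apply: eq_smooth (smoothD fi gi) => x _ /=; case: (f x) (g x) => ? ? [].
Qed.

Lemma csmoothM (f g : V -> Cplx R) :
  csmooth f -> csmooth g -> csmooth (fun x => f x * g x).
Proof.
move=> [fr fi] [gr gi]; split.
  have m1 k : Ck_on k U (fun=> -1) by exact: Ck_on_cst.
  apply: eq_smooth (smoothD (smoothM fr gr) (smoothM m1 (smoothM fi gi))) => x _ /=.
  by case: (f x) (g x) => ? ? [? ?] /=; ring.
apply: eq_smooth (smoothD (smoothM fr gi) (smoothM fi gr)) => x _ /=.
by case: (f x) (g x) => ? ? [].
Qed.

End Smooth.

Section Wirtinger.
Variables (R : realType) (U : set (R * R)).
Hypothesis U_open : open U.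
Implicit Types f g : R * R -> Cplx R.

Lemma eq_dirder v f g x : (forall y, U y -> f y = g y) -> U x ->
  dirder v f x = dirder v g x.
Proof.
move=> fg Ux; rewrite /dirder; congr (_ +i* _); apply: near_eq_derive;
  by apply: (near_eq_on U_open) => // y /fg ->.
Qed.

Lemma dirderD v f g x : csmooth U f -> csmooth U g -> U x ->
  dirder v (fun y => f y + g y) x = dirder v f x + dirder v g x.
Proof.
move=> [fr fi] [gr gi] Ux.
have [dfr dfi] := (smooth_derivable (v := v) fr Ux, smooth_derivable (v := v) fi Ux).
have [dgr dgi] := (smooth_derivable (v := v) gr Ux, smooth_derivable (v := v) gi Ux).
rewrite /dirder.
transitivity (('D_v (fun y => complex.Re (f y)) x + 'D_v (fun y => complex.Re (g y)) x)
   +i* ('D_v (fun y => complex.Im (f y)) x + 'D_v (fun y => complex.Im (g y)) x)); last by [].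
rewrite -(deriveD dfr dgr) -(deriveD dfi dgi).
by congr ('D_v _ x +i* 'D_v _ x); apply/funext => y;
  rewrite !fctE; case: (f y) (g y) => ? ? [].
Qed.

Lemma dirder_cst v (c : Cplx R) x : dirder v (fun=> c) x = 0.
Proof. by rewrite /dirder !derive_cst. Qed.

Lemma dirderM v f g x : csmooth U f -> csmooth U g -> U x ->
  dirder v (fun y => f y * g y) x = dirder v f x * g x + f x * dirder v g x.
Proof.
move=> [fr fi] [gr gi] Ux.
have [dfr dfi] := (smooth_derivable (v := v) fr Ux, smooth_derivable (v := v) fi Ux).
have [dgr dgi] := (smooth_derivable (v := v) gr Ux, smooth_derivable (v := v) gi Ux).
rewrite /dirder.
transitivity ('D_v ((fun y => complex.Re (f y)) * (fun y => complex.Re (g y))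
    - (fun y => complex.Im (f y)) * (fun y => complex.Im (g y))) x
  +i* 'D_v ((fun y => complex.Re (f y)) * (fun y => complex.Im (g y))
    + (fun y => complex.Im (f y)) * (fun y => complex.Re (g y))) x).
  by congr ('D_v _ x +i* 'D_v _ x); apply/funext => y;
    rewrite !fctE; case: (f y) (g y) => ? ? [].
rewrite (deriveB (derivableM dfr dgr) (derivableM dfi dgi)).
rewrite (deriveD (derivableM dfr dgi) (derivableM dfi dgr)).
rewrite (deriveM dfr dgr) (deriveM dfi dgi) (deriveM dfr dgi) (deriveM dfi dgr).
move: (derive _ _ _) (derive _ _ _) (derive _ _ _) (derive _ _ _).
case: (f x) (g x) => fx fy [gx gy] /= d1 d2 d3 d4.
rewrite -![_ *: _]/(_ * _); apply/eqP; rewrite eq_complex /=.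
by apply/andP; split; apply/eqP; ring.
Qed.

Lemma csmooth_dirder v f : csmooth U f -> csmooth U (dirder v f).
Proof. by move=> [fr fi]; split; exact: smooth_derive. Qed.

Definition wirt f (x : R * R) : Cplx R :=
  (dirder (1, 0) f x - iunit R * dirder (0, 1) f x) / 2.

Lemma eq_wirt f g x : (forall y, U y -> f y = g y) -> U x -> wirt f x = wirt g x.
Proof. by move=> fg Ux; rewrite /wirt !(eq_dirder _ fg Ux). Qed.

Lemma wirtD f g x : csmooth U f -> csmooth U g -> U x ->
  wirt (fun y => f y + g y) x = wirt f x + wirt g x.
Proof.
move=> sf sg Ux; rewrite /wirt !dirderD //.
by move: (dirder _ _ _) (dirder _ _ _) (dirder _ _ _) (dirder _ _ _) => a b c e; field.
Qed.

Lemma wirtM f g x : csmooth U f -> csmooth U g -> U x ->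
  wirt (fun y => f y * g y) x = wirt f x * g x + f x * wirt g x.
Proof.
move=> sf sg Ux; rewrite /wirt !dirderM //.
move: (dirder _ _ _) (dirder _ _ _) (dirder _ _ _) (dirder _ _ _) => a b c e.
by move: (f x) (g x) => u w; field.
Qed.

Lemma wirt_cst (c : Cplx R) x : wirt (fun=> c) x = 0.
Proof. by rewrite /wirt !dirder_cst mulr0 subr0 mul0r. Qed.

Lemma csmooth_wirt f : csmooth U f -> csmooth U (wirt f).
Proof.
move=> sf.
have sd v := csmooth_dirder v sf.
have s1 := csmoothM U_open (csmooth_cst U_open (- iunit R)) (sd (0, 1)).
have s2 := csmoothM U_open (csmoothD U_open (sd (1, 0)) s1) (csmooth_cst U_open 2^-1).
apply: (eq_csmooth U_open) s2 => x _.
by rewrite /wirt mulNr.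
Qed.

End Wirtinger.

(** * Matrix-valued functions as a ring with a derivation *)

Section MatrixFunctions.
Variables (R : realType) (U : set (R * R)).
Hypothesis U_open : open U.

Definition mxwirt m n (F : R * R -> 'M[Cplx R]_(m, n)) (x : R * R) : 'M[Cplx R]_(m, n) :=
  \matrix_(i, j) wirt (fun y => F y i j) x.

Lemma eq_mxwirt m n (F G : R * R -> 'M[Cplx R]_(m, n)) x :
  (forall y, U y -> F y = G y) -> U x -> mxwirt F x = mxwirt G x.
Proof.
by move=> FG Ux; apply/matrixP => i j; rewrite !mxE;
  apply: (eq_wirt U_open) => // y /FG ->.
Qed.

Lemma eq_mx_smooth m n (F G : R * R -> 'M[Cplx R]_(m, n)) :
  (forall y, U y -> F y = G y) -> mx_smooth_on U F -> mx_smooth_on U G.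
Proof.
by move=> FG sF i j; apply: (eq_csmooth U_open) (sF i j) => y /FG ->.
Qed.

Lemma mx_smooth_cst m n (c : 'M[Cplx R]_(m, n)) : mx_smooth_on U (fun=> c).
Proof. by move=> i j; exact: csmooth_cst. Qed.

Lemma mx_smoothD m n (F G : R * R -> 'M[Cplx R]_(m, n)) :
  mx_smooth_on U F -> mx_smooth_on U G -> mx_smooth_on U (fun x => F x + G x).
Proof.
move=> sF sG i j; apply: (eq_csmooth U_open) (csmoothD U_open (sF i j) (sG i j)) => x _.
by rewrite mxE.
Qed.

Lemma csmooth_sum (I : Type) (s : seq I) (f : I -> R * R -> Cplx R) :
  (forall i, csmooth U (f i)) -> csmooth U (fun x => \sum_(i <- s) f i x).
Proof.
move=> sf; elim: s => [|i s IH].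
  by apply: (eq_csmooth U_open) (csmooth_cst U_open 0) => x _; rewrite big_nil.
by apply: (eq_csmooth U_open) (csmoothD U_open (sf i) IH) => x _; rewrite big_cons.
Qed.

Lemma wirt_sum (I : Type) (s : seq I) (f : I -> R * R -> Cplx R) x :
  (forall i, csmooth U (f i)) -> U x ->
  wirt (fun y => \sum_(i <- s) f i y) x = \sum_(i <- s) wirt (f i) x.
Proof.
move=> sf Ux; elim: s => [|i s IH].
  rewrite big_nil -[RHS](wirt_cst (0 : Cplx R) x).
  by apply: (eq_wirt U_open) => // y _; rewrite big_nil.
rewrite big_cons -IH -(wirtD (sf i) (csmooth_sum s sf) Ux).
by apply: (eq_wirt U_open) => // y _; rewrite big_cons.
Qed.

Lemma mx_smoothM m n k (F : R * R -> 'M[Cplx R]_(m, n)) (G : R * R -> 'M[Cplx R]_(n, k)) :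
  mx_smooth_on U F -> mx_smooth_on U G -> mx_smooth_on U (fun x => F x *m G x).
Proof.
move=> sF sG i j.
have s l := csmoothM U_open (sF i l) (sG l j).
by apply: (eq_csmooth U_open) (csmooth_sum (index_enum _) s) => x _; rewrite mxE.
Qed.

Lemma mx_smoothZ m n (c : Cplx R) (F : R * R -> 'M[Cplx R]_(m, n)) :
  mx_smooth_on U F -> mx_smooth_on U (fun x => c *: F x).
Proof.
move=> sF i j.
apply: (eq_csmooth U_open) (csmoothM U_open (csmooth_cst U_open c) (sF i j)) => x _.
by rewrite mxE.
Qed.

Lemma mx_smooth_mxwirt m n (F : R * R -> 'M[Cplx R]_(m, n)) :
  mx_smooth_on U F -> mx_smooth_on U (mxwirt F).
Proof.
move=> sF i j; apply: (eq_csmooth U_open) (csmooth_wirt U_open (sF i j)) => x _.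
by rewrite mxE.
Qed.

Lemma mxwirtD m n (F G : R * R -> 'M[Cplx R]_(m, n)) x :
  mx_smooth_on U F -> mx_smooth_on U G -> U x ->
  mxwirt (fun y => F y + G y) x = mxwirt F x + mxwirt G x.
Proof.
move=> sF sG Ux; apply/matrixP => i j; rewrite !mxE.
have -> : (fun y => (F y + G y) i j) = (fun y => F y i j + G y i j).
  by apply/funext => y; rewrite mxE.
exact: wirtD (sF i j) (sG i j) Ux.
Qed.

Lemma mxwirt_cst m n (c : 'M[Cplx R]_(m, n)) x : mxwirt (fun=> c) x = 0.
Proof. by apply/matrixP => i j; rewrite !mxE wirt_cst. Qed.

Lemma mxwirtM m n k (F : R * R -> 'M[Cplx R]_(m, n)) (G : R * R -> 'M[Cplx R]_(n, k)) x :
  mx_smooth_on U F -> mx_smooth_on U G -> U x ->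
  mxwirt (fun y => F y *m G y) x = mxwirt F x *m G x + F x *m mxwirt G x.
Proof.
move=> sF sG Ux; apply/matrixP => i j; rewrite !mxE -big_split /=.
have s l := csmoothM U_open (sF i l) (sG l j).
have -> : (fun y => (F y *m G y) i j) = (fun y => \sum_l F y i l * G y l j).
  by apply/funext => y; rewrite mxE.
rewrite wirt_sum //; apply: eq_bigr => l _.
by rewrite (wirtM (sF i l) (sG l j) Ux) !mxE.
Qed.

Lemma mxwirtZ m n (c : Cplx R) (F : R * R -> 'M[Cplx R]_(m, n)) x :
  mx_smooth_on U F -> U x -> mxwirt (fun y => c *: F y) x = c *: mxwirt F x.
Proof.
move=> sF Ux; rewrite -[RHS]mul_scalar_mx -[RHS]add0r -(mul0mx _ (F x)).
rewrite -(mxwirt_cst c%:M x) -(mxwirtM (mx_smooth_cst _) sF Ux).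
have -> // : (fun y => c *: F y) = (fun y => c%:M *m F y).
by apply/funext => y; rewrite mul_scalar_mx.
Qed.

(** Extension by zero makes two functions equal as soon as they agree on the
    open set, so that identities valid there become equalities in a ring. *)
Definition restr0 T (Z : zmodType) (A : set T) (F : T -> Z) (x : T) : Z :=
  if `[< A x >] then F x else 0.

Lemma restr0_in T (Z : zmodType) (A : set T) (F : T -> Z) x : A x -> restr0 A F x = F x.
Proof. by move=> Ax; rewrite /restr0 asboolT. Qed.

Lemma restr0_out T (Z : zmodType) (A : set T) (F : T -> Z) x : ~ A x -> restr0 A F x = 0.
Proof. by move=> Ax; rewrite /restr0 asboolF. Qed.

Lemma eq_restr0 T (Z : zmodType) (A : set T) (F G : T -> Z) :
  (forall x, ~ A x -> G x = 0) -> (forall x, A x -> F x = G x) -> restr0 A F = G.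
Proof.
move=> G0 FG; apply/funext => x; have [Ax|nAx] := pselect (A x).
  by rewrite restr0_in // FG.
by rewrite restr0_out // G0.
Qed.

Definition smooth_restr n (F : R * R -> 'M[Cplx R]_n) :=
  mx_smooth_on U F /\ forall x, ~ U x -> F x = 0.

Lemma restr0_smooth n (F : R * R -> 'M[Cplx R]_n) :
  mx_smooth_on U F -> smooth_restr (restr0 U F).
Proof.
move=> sF; split=> [|x nUx]; last exact: restr0_out.
by apply: eq_mx_smooth sF => x Ux; rewrite restr0_in.
Qed.

Definition der_restr n (F : R * R -> 'M[Cplx R]_n) := restr0 U (mxwirt F).

Lemma der_restr_derivation n :
  derivation_on (@smooth_restr n) (@der_restr n).
Proof.
split.
- by split=> //; exact: (mx_smooth_cst 0).
- move=> F G [sF F0] [sG G0]; split; first exact: mx_smoothD.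
  by move=> x nUx; rewrite fctE F0 // G0 // addr0.
- move=> F [sF F0]; split; last by move=> x nUx; rewrite fctE F0 // oppr0.
  by apply: eq_mx_smooth (mx_smoothZ (-1) sF) => x _; rewrite scaleN1r.
- move=> F G [sF F0] [sG G0]; split; first exact: mx_smoothM.
  by move=> x nUx; rewrite fctE F0 // mul0r.
- by move=> F [sF F0]; apply: restr0_smooth; exact: mx_smooth_mxwirt.
- move=> F G [sF F0] [sG G0]; apply: eq_restr0 => x Ux.
    rewrite [LHS](_ : _ = restr0 U (mxwirt F) x + restr0 U (mxwirt G) x) //.
    by rewrite !restr0_out // addr0.
  rewrite [RHS](_ : _ = restr0 U (mxwirt F) x + restr0 U (mxwirt G) x) // !restr0_in //.
  exact: mxwirtD.
- move=> F G [sF F0] [sG G0]; apply: eq_restr0 => x Ux.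
    rewrite [LHS](_ : _ = restr0 U (mxwirt F) x *m G x + F x *m restr0 U (mxwirt G) x) //.
    by rewrite !restr0_out // F0 // !mul0mx addr0.
  rewrite [RHS](_ : _ = restr0 U (mxwirt F) x *m G x + F x *m restr0 U (mxwirt G) x) //.
  by rewrite !restr0_in //; exact: mxwirtM.
Qed.

Lemma der_const_scalar n (c : Cplx R) :
  der_const (@smooth_restr n) (@der_restr n) (fun=> c%:M).
Proof.
have E (F : R * R -> 'M[Cplx R]_n) : (fun=> c%:M) * F = (fun y => c *: F y).
  by apply/funext => y; rewrite fctE -mul_scalar_mx.
split=> F.
- by rewrite E; apply/funext => y; rewrite fctE -mul_mx_scalar.
- rewrite E; move=> [sF F0]; split; first exact: mx_smoothZ.
  by move=> y nUy; rewrite F0 // scaler0.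
rewrite !E; move=> [sF F0]; apply: eq_restr0 => y Uy.
  by rewrite /der_restr restr0_out // scaler0.
by rewrite /der_restr restr0_in // mxwirtZ.
Qed.

End MatrixFunctions.

(** * Charts and removable points *)

Section Charts.
Variables (R : realType) (M : topologicalType) (a : chart R M).

(** The plane carries the product topology and the complex numbers that of
    their modulus. *)
Lemma of_xy_continuous : continuous (@of_xy R : R * R -> Cplx R).
Proof.
move=> x; apply/cvgrPdist_lt => e e0.
have [r r0 ->] : exists2 r : R, 0 < r & e = r%:C.
  move: e0; case: e => er ei; rewrite ltcE /= => /andP[/eqP-> er0].
  by exists er.
have r20 : 0 < r / 2 by rewrite divr_gt0.
have /cvgrPdist_lt/(_ _ r20) h1 : (fun y : R * R => y.1) @ x --> x.1 by exact: cvg_fst.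
have /cvgrPdist_lt/(_ _ r20) h2 : (fun y : R * R => y.2) @ x --> x.2 by exact: cvg_snd.
near=> y.
have d1 : `|x.1 - y.1| < r / 2 by near: y.
have d2 : `|x.2 - y.2| < r / 2 by near: y.
have -> : of_xy x - of_xy y = (x.1 - y.1)%:C + iunit R * (x.2 - y.2)%:C.
  by apply/eqP; rewrite eq_complex /= !mul0r !mul1r subr0 addr0 !add0r !eqxx.
apply: le_lt_trans (ler_normD _ _) _.
have N (u : R) : `|(u%:C : Cplx R)| = `|u|%:C by rewrite [LHS]normc_def /= expr0n addr0 sqrtr_sqr.
have Ni : `|iunit R| = 1 by rewrite [LHS]normc_def /= expr0n expr1n add0r sqrtr1.
rewrite normrM Ni mul1r !N -rmorphD /= ltcR [r in X in _ < X]splitr.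
exact: ltrD.
Unshelve. all: by end_near. Qed.

Definition chart_xy : set (R * R) := [set x | (a @` chart_dom a) (of_xy x)].

Lemma chart_xy_open : open chart_xy.
Proof.
by move/continuousP: of_xy_continuous; apply; exact: chart_img_open.
Qed.

Lemma of_xyK : cancel (@of_xy R) (@to_xy R).
Proof. by case. Qed.

Lemma to_xyK : cancel (@to_xy R) (@of_xy R).
Proof. by case. Qed.

Lemma chart_xyP p : chart_dom a p -> chart_xy (to_xy (a p)).
Proof. by move=> ap; exists p => //; rewrite to_xyK. Qed.

Lemma in_chart_at T (f : M -> T) p : chart_dom a p -> in_chart a f (to_xy (a p)) = f p.
Proof. by move=> ap; rewrite /in_chart to_xyK chart_mapK. Qed.

Lemma dz_mxwirt m n (F : M -> 'M[Cplx R]_(m, n)) p :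
  dz a F p = mxwirt (in_chart a F) (to_xy (a p)).
Proof. by []. Qed.

(** A point of a Riemann surface is not isolated, so a continuous function
    vanishing around it vanishes there. The point is approached along a
    horizontal segment of the chart. *)
Lemma punctured_zero m n (F : R * R -> 'M[Cplx R]_(m, n)) p : chart_dom a p ->
  mx_smooth_on chart_xy F ->
  (\forall q \near p^', chart_dom a q -> F (to_xy (a q)) = 0) ->
  F (to_xy (a p)) = 0.
Proof.
move=> ap sF F0; set x := to_xy (a p).
pose path (h : R) : R * R := (x.1 + h, x.2).
have path0 : path 0 = x by rewrite /path addr0; case: (x).
have pc : {for 0, continuous path}.
  have c1 : x.1 + h @[h --> (0 : R)] --> x.1 + 0 by apply: cvgD; [exact: cvg_cst|exact: cvg_id].
  have c2 : (fun=> x.2) @ (0 : R) --> x.2 by exact: cvg_cst.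
  exact: cvg_pair c1 c2.
have cp : path h @[h --> (0 : R)^'] --> x by rewrite -path0; apply/continuous_withinNx.
have Ux : chart_xy x by exact: chart_xyP.
have z : \forall h \near (0 : R)^', F (path h) = 0.
  have qc : chart_inv a (of_xy (path h)) @[h --> (0 : R)] --> p.
    have ic : {for of_xy (path 0), continuous (chart_inv a)}.
      by apply: chart_inv_continuous; rewrite path0.
    have := cvg_comp _ _ (cvg_comp _ _ pc (@of_xy_continuous _)) ic.
    by rewrite path0 /x to_xyK chart_mapK.
  have Uh : \forall h \near (0 : R), chart_xy (path h).
    have Un : nbhs (path 0) chart_xy.
      by rewrite path0; apply: open_nbhs_nbhs; split=> //; exact: chart_xy_open.
    exact: (pc _ Un).
  have := qc _ F0; rewrite /= => F0'.
  apply: filterS (filterI Uh F0') => h [[q aq qE] F0h] h0.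
  have iE : chart_inv a (of_xy (path h)) = q by rewrite -qE chart_mapK.
  move: F0h; rewrite /= iE qE of_xyK; apply=> //.
  apply/eqP => qp; move: qE; rewrite qp => /(congr1 (@to_xy R)).
  rewrite of_xyK -/x => /(congr1 fst)/= /eqP.
  by rewrite eq_sym -subr_eq0 addrAC subrr add0r (negPf h0).
have lim0 (f : R * R -> R) : smooth_on chart_xy f ->
    (\forall h \near (0 : R)^', f (path h) = 0) -> f x = 0.
  move=> sf fz; have [/(_ _ Ux) cf _] := sf 0%N.
  have c1 : f (path h) @[h --> (0 : R)^'] --> f x by exact: cvg_comp _ _ cp cf.
  have c2 : f (path h) @[h --> (0 : R)^'] --> (0 : R).
    apply: cvg_trans (near_eq_cvg _) (cvg_cst _).
    by apply: filterS fz => h ->.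
  exact: (cvg_unique (@Rhausdorff R) c1 c2).
apply/matrixP => i j; rewrite mxE; have [sr si] := sF i j.
apply/eqP; rewrite eq_complex /=; apply/andP; split; apply/eqP.
  by apply: (lim0 _ sr); apply: filterS z => h ->; rewrite mxE.
by apply: (lim0 _ si); apply: filterS z => h ->; rewrite mxE.
Qed.
End Charts.

(** * Gauss bundles *)

Section GaussBundles.
Variables (R : realType) (n : nat).
Implicit Types (al be : Csubspace R n).

Lemma mx_eq_cols m k (A B : 'M[Cplx R]_(m, k)) :
  (forall v : 'cV_k, A *m v = B *m v) -> A = B.
Proof.
move=> AB; apply/matrixP => i j.
by have /colP/(_ i) := AB (delta_mx j 0); rewrite -!colE !mxE.
Qed.

Lemma hproj_mulP al m (A : 'M[Cplx R]_(n, m)) :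
  (forall v : 'cV_m, A *m v \in al) -> hproj al *m A = A.
Proof.
by move=> Aal; apply: mx_eq_cols => v; rewrite -mulmxA; apply/eqP; rewrite -hproj_id.
Qed.

Lemma orthogonal_hproj al be : orthogonal_sub al be <-> hproj al *m hproj be = 0.
Proof.
split=> [ho|h u v].
  apply: mx_eq_cols => v; rewrite mul0mx -mulmxA.
  have : hproj be *m v \in perp al by apply/perpP => u ual; apply: ho => //; exact: hproj_mem.
  by rewrite memv_ker lfunE => /eqP.
rewrite !hproj_id; move: (hproj_herm al) h; move: (hproj al) (hproj be) => P Q Ph PQ.
move=> /eqP <- /eqP <-.
by rewrite trmx_mul map_mxM Ph -mulmxA (mulmxA P) PQ mul0mx mulmx0.
Qed.

Lemma hproj0 : hproj (0%VS : Csubspace R n) = 0.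
Proof.
apply: mx_eq_cols => v; rewrite mul0mx; apply/eqP; rewrite -memv0; exact: hproj_mem.
Qed.

Lemma hproj_eq0 al : hproj al = 0 -> al = 0%VS.
Proof.
move=> h; apply/eqP; rewrite -subv0; apply/subvP => v.
by rewrite hproj_id h mul0mx eq_sym memv0.
Qed.

Variable M : riemannSurface R.
Implicit Types (phi psi : M -> Csubspace R n).

Definition smooth_bundle phi := smooth_map (fun p => hproj (phi p)).

Lemma sff_perpE (a : chart R M) phi p : let P := in_chart a (fun q => hproj (phi q)) in
  chart_dom a p ->
  sff_perp a phi p = (1%:M - P (to_xy (a p))) *m mxwirt P (to_xy (a p)) *m P (to_xy (a p)).
Proof. by move=> P ap; rewrite /sff_perp /sff hproj_perp dz_mxwirt /P in_chart_at. Qed.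

Lemma mx_smooth_sff (a : chart R M) (P : R * R -> 'M[Cplx R]_n) :
  mx_smooth_on (chart_xy a) P ->
  mx_smooth_on (chart_xy a) (fun x => (1%:M - P x) *m mxwirt P x *m P x).
Proof.
move=> sP; have Uo := chart_xy_open (a := a).
apply: (mx_smoothM Uo _ sP); apply: (mx_smoothM Uo); last exact: mx_smooth_mxwirt.
apply: (mx_smoothD Uo); first exact: mx_smooth_cst.
by apply: (eq_mx_smooth Uo) (mx_smoothZ Uo (-1) sP) => x _; rewrite scaleN1r.
Qed.

(** An identity between smooth matrix functions may be checked where psi is the
    image of the second fundamental form of phi. *)
Let is_gauss_punctured phi psi (a : chart R M) p (F : R * R -> 'M[Cplx R]_n) :
  is_gauss phi psi -> rs_atlas a -> chart_dom a p ->
  mx_smooth_on (chart_xy a) F ->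
  (forall q, chart_dom a q ->
    psi q = (linfun (mulmx (sff_perp a phi q) :
                 'cV[Cplx R]_n -> 'cV[Cplx R]_n) @: phi q)%VS -> F (to_xy (a q)) = 0) ->
  F (to_xy (a p)) = 0.
Proof.
move=> [_ g] aa ap sF h; apply: (punctured_zero ap sF).
by apply: filterS (g _ _ aa ap) => q qE aq; exact: h.
Qed.

Lemma is_gauss_smooth phi psi : is_gauss phi psi -> smooth_bundle psi.
Proof. by move=> [[r []]]. Qed.

Lemma is_gauss_sff phi psi (a : chart R M) p : smooth_bundle phi -> is_gauss phi psi ->
  rs_atlas a -> chart_dom a p ->
  hproj (psi p) *m sff_perp a phi p = sff_perp a phi p.
Proof.
move=> sphi g aa ap; have Uo := chart_xy_open (a := a).
have spsi := is_gauss_smooth g.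
pose P := in_chart a (fun q => hproj (phi q)).
pose Q := in_chart a (fun q => hproj (psi q)).
pose B x := (1%:M - P x) *m mxwirt P x *m P x.
have sB : mx_smooth_on (chart_xy a) B by apply: mx_smooth_sff; exact: sphi.
pose F x := Q x *m B x + (-1) *: B x.
have sF : mx_smooth_on (chart_xy a) F.
  by apply: (mx_smoothD Uo); [apply: (mx_smoothM Uo) => //; exact: spsi|exact: mx_smoothZ].
have FE q : chart_dom a q ->
    F (to_xy (a q)) = hproj (psi q) *m sff_perp a phi q - sff_perp a phi q.
  move=> aq; have QE : Q (to_xy (a q)) = hproj (psi q) by exact: in_chart_at.
  have BE : B (to_xy (a q)) = sff_perp a phi q by exact/esym/sff_perpE.
  by rewrite /F QE BE scaleN1r.
apply/eqP; rewrite -subr_eq0 -FE //; apply/eqP.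
apply: (is_gauss_punctured g aa ap sF) => q aq psiE.
rewrite FE //; apply/eqP; rewrite subr_eq0; apply/eqP; apply: hproj_mulP => v; rewrite psiE.
have -> : sff_perp a phi q *m v = linfun (mulmx (sff_perp a phi q) :
    'cV[Cplx R]_n -> 'cV[Cplx R]_n) (hproj (phi q) *m v).
  rewrite lfunE /= /sff_perp /sff; move: (hproj_idem (phi q)).
  move: (dz _ _ _) (hproj (perp _)) (hproj (phi q)) => D Q' P' PP.
  by rewrite -!mulmxA (mulmxA P') PP.
by apply: memv_img; exact: hproj_mem.
Qed.

Lemma is_gauss_orthogonal phi psi p : smooth_bundle phi -> is_gauss phi psi ->
  orthogonal_sub (phi p) (psi p).
Proof.
move=> sphi g; apply/orthogonal_hproj.
have [a aa ap] := rs_cover p; have Uo := chart_xy_open (a := a).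
pose P := in_chart a (fun q => hproj (phi q)).
pose Q := in_chart a (fun q => hproj (psi q)).
have sF : mx_smooth_on (chart_xy a) (fun x => P x *m Q x).
  by apply: (mx_smoothM Uo); [exact: sphi|exact: is_gauss_smooth g _ aa].
have PE q : chart_dom a q -> P (to_xy (a q)) = hproj (phi q) by exact: in_chart_at.
have QE q : chart_dom a q -> Q (to_xy (a q)) = hproj (psi q) by exact: in_chart_at.
rewrite -PE // -QE //.
apply: (is_gauss_punctured g aa ap sF) => q aq psiE; rewrite PE // QE //.
apply/orthogonal_hproj => u v; rewrite psiE hproj_id => uphi /memv_imgP [w _ ->].
rewrite lfunE /= /sff_perp /sff hproj_perp.
move: (hproj_herm (phi q)) (hproj_idem (phi q)) uphi.
move: (dz _ _ _) (hproj (phi q)) => D A Ah AA /eqP <-.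
rewrite trmx_mul map_mxM Ah !mulmxA -(mulmxA (u ^t*)) mulmxBr mulmx1 AA.
by rewrite subrr mulmx0 !mul0mx.
Qed.

Lemma gauss_is_gauss_or0 phi : is_gauss phi (gauss phi) \/ gauss phi = (fun=> 0%VS).
Proof. by rewrite /gauss; case: xgetP => [psi -> ?|]; [left|right]. Qed.

Lemma gauss_smooth phi : smooth_bundle (gauss phi).
Proof.
have [/is_gauss_smooth //|->] := gauss_is_gauss_or0 phi.
move=> a aa; exact: (mx_smooth_cst (chart_xy_open (a := a))).
Qed.

(** A Gauss bundle of the zero bundle vanishes on a punctured neighbourhood of
    every point, hence everywhere by continuity. *)
Lemma gauss0 : gauss (fun=> 0%VS) = (fun=> 0%VS) :> (M -> Csubspace R n).
Proof.
have [g|//] := gauss_is_gauss_or0 (fun=> 0%VS); apply/funext => p; apply: hproj_eq0.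
have [a aa ap] := rs_cover p; rewrite -(in_chart_at (fun q => hproj (gauss _ q)) ap).
apply: (is_gauss_punctured g aa ap); first exact: gauss_smooth.
by move=> q aq gE; rewrite in_chart_at // gE limg0 hproj0.
Qed.

Lemma gauss_iter_smooth phi i : smooth_bundle phi -> smooth_bundle (gauss_iter i phi).
Proof.
case: i => [|i] sphi; first exact: sphi.
exact: (@gauss_smooth (gauss_iter i phi)).
Qed.

(** Once an iterated Gauss bundle is the dummy zero bundle, all the later ones
    are zero, hence orthogonal to phi. *)
Lemma gauss_iter_is_gauss phi i k p : (i < k)%N ->
  ~ orthogonal_sub (phi p) (gauss_iter k phi p) ->
  is_gauss (gauss_iter i phi) (gauss_iter i.+1 phi).
Proof.
move=> ik no; have [//|g0] := gauss_is_gauss_or0 (gauss_iter i phi).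
exfalso; apply: no; suff -> : gauss_iter k phi = fun=> 0%VS.
  by apply/orthogonal_hproj; rewrite hproj0 mulmx0.
elim: k ik => // k IH; rewrite ltnS leq_eqVlt => /predU1P[<- //|/IH kz].
by rewrite /gauss_iter iterS -/(gauss_iter k phi) kz gauss0.
Qed.

Lemma isotropic_upto1 phi : smooth_bundle phi -> isotropic_upto phi 1.
Proof.
move=> sphi i p; rewrite -eqn_leq => /eqP <-; rewrite /gauss_iter /=.
have [g|->] := gauss_is_gauss_or0 phi; first exact: is_gauss_orthogonal.
by apply/orthogonal_hproj; rewrite hproj0 mulmx0.
Qed.

(** t + 1 is the first index where orthogonality fails; orthogonality to G^(1)
    always holds, so that t is positive. *)
Lemma isotropy_order_exists phi : smooth_bundle phi -> ~ strongly_isotropic phi ->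
  exists t p, finite_isotropy_order phi t /\
    ~ orthogonal_sub (phi p) (gauss_iter t.+1 phi p).
Proof.
move=> sphi nsi; pose bad i := `[< (0 < i)%N /\
  exists p, ~ orthogonal_sub (phi p) (gauss_iter i phi p) >].
have ex : exists i, bad i.
  apply: contrapT => nex; apply: nsi => i p i0; apply: contrapT => no.
  by apply: nex; exists i; apply/asboolP; split=> //; exists p.
case: (ex_minnP ex) => [[|t] /asboolP[//= _ [p no]] tmin].
have up s : isotropic_upto phi s -> (s <= t)%N.
  by move=> us; rewrite leqNgt; apply/negP => ts; exact/no/(us t.+1 p).
exists t, p; split=> //; split=> //; first exact/up/isotropic_upto1.
move=> i q /andP[i0 it]; apply: contrapT => noq.
suff : (t.+1 <= i)%N by rewrite ltnNge it.
by apply: tmin; apply/asboolP; split=> //; exists q.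
Qed.

End GaussBundles.

(** The Cartan embedding is 2 P - 1. *)
Lemma smooth_bundle_cartan (R : realType) (n : nat) (M : riemannSurface R)
    (phi : M -> Csubspace R n) :
  smooth_map (fun p => cartan (phi p)) -> smooth_bundle phi.
Proof.
move=> sF a aa; have Uo := chart_xy_open (a := a).
pose G x := 2^-1 *: (in_chart a (fun p => cartan (phi p)) x + 1%:M).
have sG : mx_smooth_on (chart_xy a) G.
  by apply: (mx_smoothZ Uo); apply: (mx_smoothD Uo); [exact: sF|exact: mx_smooth_cst].
apply: (eq_mx_smooth Uo) sG => x _.
rewrite /G /in_chart /cartan hproj_perp; move: (hproj _) => Q.
by rewrite opprB addrA addrNK -mulr2n -(scaler_nat 2 Q) scalerA mulVf ?pnatr_eq0 // scale1r.
Qed.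


(** * The first return map *)

Lemma adjoint_sumZ (C : numClosedFieldType) (n m : nat) (c : 'I_m -> C) (A : 'I_m -> 'M[C]_n) :
  (\sum_k c k *: A k)^t* = \sum_k Num.conj (c k) *: (A k)^t*.
Proof.
apply/matrixP => i j; rewrite !mxE !summxE rmorph_sum; apply: eq_bigr => k _.
by rewrite !mxE rmorphM.
Qed.

Section FirstReturn.
Variables (R : realType) (n : nat) (M : riemannSurface R).
Variables (phi : M -> Csubspace R n) (t : nat) (a : chart R M).
Hypothesis phi_smooth : smooth_bundle phi.
Hypothesis t_gt0 : (0 < t)%N.
Hypothesis phi_isotropic : isotropic_upto phi t.
Hypothesis gaussP : forall i, (i < t)%N ->
  is_gauss (gauss_iter i phi) (gauss_iter i.+1 phi).
Hypothesis aa : rs_atlas a.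

Let U := chart_xy a.
Let Uo : open U := chart_xy_open (a := a).
Let d := @der_restr R U n.
Let dS := der_restr_derivation Uo n.
Let pull (F : M -> 'M[Cplx R]_n) := restr0 U (in_chart a F).
Let P j := pull (fun q => hproj (gauss_iter j phi q)).

Let pull_at F q : chart_dom a q -> pull F (to_xy (a q)) = F q.
Proof. by move=> aq; rewrite /pull restr0_in ?in_chart_at //; exact: chart_xyP. Qed.

Let pull_smooth F : smooth_map F -> smooth_restr U (pull F).
Proof. by move=> sF; apply: restr0_smooth => //; exact: sF. Qed.

Let eq_pull (F G : R * R -> 'M[Cplx R]_n) : (forall x, ~ U x -> F x = G x) ->
  (forall q, chart_dom a q -> F (to_xy (a q)) = G (to_xy (a q))) -> F = G.
Proof.
move=> FG0 FG; apply/funext => x; have [[q aq qE]|/FG0 //] := pselect (U x).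
by rewrite -(of_xyK x) -qE FG.
Qed.

Let d_pull F q : chart_dom a q -> d (pull F) (to_xy (a q)) = dz a F q.
Proof.
move=> aq; have Uq := chart_xyP aq; apply: (etrans (restr0_in _ Uq)).
by apply: (eq_mxwirt Uo _ Uq) => y; exact: restr0_in.
Qed.

Let P_at j q : chart_dom a q -> P j (to_xy (a q)) = hproj (gauss_iter j phi q).
Proof. exact: pull_at. Qed.

Let P_off j x : ~ U x -> P j x = 0.
Proof. exact: restr0_out. Qed.

Let SP j : smooth_restr U (P j).
Proof. exact/pull_smooth/gauss_iter_smooth. Qed.

Let mul_at (F G : R * R -> 'M[Cplx R]_n) x : (F * G) x = F x *m G x.
Proof. by []. Qed.

Let PP j : P j * P j = P j.
Proof.
apply: eq_pull => [x Ux|q aq]; rewrite mul_at; first by rewrite (P_off _ Ux) mul0mx.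
by rewrite (P_at _ aq) hproj_idem.
Qed.

Let P0P j : (0 < j <= t)%N -> P 0%N * P j = 0.
Proof.
move=> jt; apply: eq_pull => [x Ux|q aq]; rewrite mul_at; first by rewrite (P_off _ Ux) mul0mx.
by rewrite !(P_at _ aq); apply/orthogonal_hproj; exact: phi_isotropic.
Qed.

Let sff_at j q : chart_dom a q ->
  second_form d (P j) (to_xy (a q)) = sff_perp a (gauss_iter j phi) q.
Proof.
move=> aq; have Px := P_at j aq.
rewrite [LHS](_ : _ = d (P j) (to_xy (a q)) *m P j (to_xy (a q)) -
   P j (to_xy (a q)) *m d (P j) (to_xy (a q)) *m P j (to_xy (a q))) //.
rewrite Px (d_pull _ aq) /sff_perp /sff hproj_perp; move: (dz _ _ _) (hproj _) => D Q.
by rewrite !mulmxBl mul1mx.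
Qed.

Let sff_off j x : ~ U x -> second_form d (P j) x = 0.
Proof.
have [_] := second_formS dS (SP j); exact.
Qed.

Let PsffP j : (j < t)%N -> P j.+1 * second_form d (P j) = second_form d (P j).
Proof.
move=> jt; apply: eq_pull => [x Ux|q aq]; rewrite mul_at.
  by rewrite (sff_off j Ux) mulmx0.
rewrite (P_at _ aq) (sff_at j aq).
exact: (is_gauss_sff (gauss_iter_smooth j phi_smooth) (gaussP jt) aa aq).
Qed.

Let chain_at i q : chart_dom a q ->
  form_chain d P i (to_xy (a q)) = sff_chain a phi i q.
Proof.
move=> aq; elim: i => [|i IH]; first exact: sff_at.
rewrite [LHS](_ : _ = second_form d (P i.+1) (to_xy (a q)) *m form_chain d P i (to_xy (a q))) //.
by rewrite IH (sff_at i.+1 aq).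
Qed.

Let exp_at (F : R * R -> 'M[Cplx R]_n) j x : (F ^+ j) x = F x ^+ j.
Proof. by elim: j => [|j IH]; rewrite ?expr0 // !exprS -IH. Qed.

Let return_at j q : chart_dom a q ->
  pole_coef d (P 0%N) (j * t.+1) j.*2 (to_xy (a q)) =
  first_return a phi t q ^+ j *m hproj (phi q).
Proof.
move=> aq.
have [_ ->] := pole_coef_power dS t_gt0 (fun j _ => SP j) (fun j _ => PP j) P0P PsffP j.
by rewrite mul_at exp_at mul_at !(P_at _ aq) (chain_at _ aq).
Qed.

Variables (Phi : Cplx R -> M -> 'M[Cplx R]_n) (r s : nat).
Variable (C : int -> M -> 'M[Cplx R]_n).
Hypothesis Phi_extended : extended_solution (fun q => cartan (phi q)) Phi.
Hypothesis C_smooth : forall k, smooth_map (C k).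
Hypothesis PhiE : forall l p, `|l| = 1 -> Phi l p =
  \sum_(i < (r + s).+1) l ^ (i%:Z - r%:Z) *: C (i%:Z - r%:Z) p.

(** 2 P - 1 is an involution, hence its own inverse. *)
Let A_z_cartan q : chart_dom a q -> A_z a (fun q => cartan (phi q)) q =
  hproj (phi q) *m dz a (fun q => hproj (phi q)) q *+ 2 - dz a (fun q => hproj (phi q)) q.
Proof.
move=> aq; have Uq := chart_xyP aq; pose Q := in_chart a (fun q => hproj (phi q)).
have cE q' : cartan (phi q') = 2 *: hproj (phi q') + - 1%:M.
  by rewrite /cartan hproj_perp opprB addrA -mulr2n scaler_nat.
have -> : A_z a (fun q => cartan (phi q)) q =
    2^-1 *: (invmx (cartan (phi q)) *m dz a (fun q => cartan (phi q)) q) by [].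
have sQ : mx_smooth_on U Q by exact: phi_smooth.
have -> : dz a (fun q => cartan (phi q)) q = 2 *: dz a (fun q => hproj (phi q)) q.
  rewrite !dz_mxwirt.
  have -> : in_chart a (fun q => cartan (phi q)) = fun x => 2 *: Q x + - 1%:M.
    by apply/funext => x; exact: cE.
  rewrite (mxwirtD (mx_smoothZ Uo 2 sQ) (mx_smooth_cst Uo _) Uq).
  by rewrite mxwirt_cst addr0 (mxwirtZ Uo 2 sQ Uq).
rewrite cE; move: (hproj_idem (phi q)) (dz _ _ _) => + D.
move: (hproj (phi q)) => H HH; set F := _ + _.
have FF : F *m F = 1%:M.
  rewrite /F mulmxDl !mulmxDr -!scalemxAl -!scalemxAr HH !mulNmx !mulmxN !mulmx1 !mul1mx.
  rewrite -scalerDr [2 *: H](scaler_nat 2 H) mulr2n addrK opprK addrA scalerN.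
  by rewrite subrr add0r.
have FU : F \in unitmx by have [] := mulmx1_unit FF.
have -> : invmx F = F by rewrite -[LHS]mulmx1 -FF mulKmx.
rewrite -scalemxAr scalerA mulVf ?pnatr_eq0 // scale1r /F mulmxDl mulNmx mul1mx.
by rewrite -scalemxAl scaler_nat.
Qed.

Let C' (i : nat) := pull (C (i%:Z - r%:Z)).

(** The expansion of D_l^N P in powers of l^-1, compared with
    Phi^* (d/dz)^N (Phi P) expanded by means of the coefficients of Phi. *)
Let gauge l N q : `|l| = 1 -> chart_dom a q ->
  \sum_(m < N.+1) (l^-1) ^+ m *: pole_coef d (P 0%N) N m (to_xy (a q)) =
  \sum_(k < (r + s).+1) \sum_(i < (r + s).+1) (l ^+ i / l ^+ k) *:
    ((C (k%:Z - r%:Z) q)^t* *m iter N d (C' i * P 0%N) (to_xy (a q))).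
Proof.
move=> l1 aq; have l0 : l != 0 by rewrite -normr_eq0 l1 oner_eq0.
have [Phi_unitary _ _ Phi_der] := Phi_extended.
pose y (i : nat) : R * R -> 'M[Cplx R]_n := fun=> (l ^ (i%:Z - r%:Z))%:M.
have yc i : der_const (@smooth_restr R U n) d (y i) by exact: der_const_scalar.
have xc : der_const (@smooth_restr R U n) d (fun=> (l^-1)%:M) by exact: der_const_scalar.
have sC i : smooth_restr U (C' i) by exact: pull_smooth.
have sCP i : smooth_restr U (C' i * P 0%N) by apply: (der_SM dS).
have scale_at (c : Cplx R) (F : R * R -> 'M[Cplx R]_n) x :
  ((fun=> c%:M) * F) x = c *: F x by rewrite mul_at mul_scalar_mx.
have sum_at m (F : 'I_m -> R * R -> 'M[Cplx R]_n) x : (\sum_i F i) x = \sum_i F i x.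
  by elim/big_rec2: _ => // i u v _ <-.
have PhiC : pull (Phi l) = \sum_(i < (r + s).+1) y i * C' i.
  apply: eq_pull => [x Ux|q' aq']; rewrite sum_at.
    rewrite [LHS]restr0_out // big1 // => i _.
    by rewrite /y scale_at /C' /pull restr0_out // scaler0.
  rewrite pull_at // PhiE //; apply: eq_bigr => i _.
  by rewrite /y scale_at /C' pull_at.
have sPhi : smooth_restr U (pull (Phi l)).
  by rewrite PhiC; apply: (der_S_sum dS) => i; have [_ + _] := yc i; apply.
have dPhi : d (pull (Phi l)) = pull (Phi l) *
    ((P 0%N * d (P 0%N) *+ 2 - d (P 0%N)) -
     (fun=> (l^-1)%:M) * (P 0%N * d (P 0%N) *+ 2 - d (P 0%N))).
  apply: eq_pull => [x Ux|q' aq'].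
    by rewrite mul_at [LHS]restr0_out // [pull _ x]restr0_out // mul0mx.
  have Pq : hproj (phi q') = P 0%N (to_xy (a q')) by exact/esym/(P_at 0).
  transitivity (Phi l q' *m ((1 - l^-1) *: A_z a (fun q => cartan (phi q)) q')).
    have [<- _] := Phi_der _ _ _ l1 aa aq'.
    by rewrite mulKVmx ?d_pull //; apply: unitarymx_unit; exact: Phi_unitary.
  rewrite mul_at (pull_at _ aq'); congr (_ *m _).
  rewrite (A_z_cartan aq') scalerBl scale1r -!(d_pull _ aq') Pq.
  by rewrite -mul_scalar_mx.
have E := iter_der_gauge dS (SP 0) (PP 0) xc sPhi dPhi N.
have L : iter N d (pull (Phi l) * P 0%N) =
    \sum_(i < (r + s).+1) y i * iter N d (C' i * P 0%N).
  rewrite -(iter_der_const_sum dS N _ (fun i : 'I__ => yc i) (fun i : 'I__ => sCP i)).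
  congr (iter N d _); rewrite PhiC mulr_suml; apply: eq_bigr => i _.
  by rewrite mulrA.
have PhiU : (Phi l q)^t* *m Phi l q = 1%:M.
  by apply: mulmx1C; apply/unitarymxP; exact: Phi_unitary.
have := congr1 (fun F => (Phi l q)^t* *m F (to_xy (a q))) E.
rewrite L mul_at (pull_at _ aq) mulmxA PhiU mul1mx.
rewrite !sum_at mulmx_sumr => e.
transitivity (\sum_(m < N.+1) ((fun=> (l^-1)%:M) ^+ m * pole_coef d (P 0%N) N m) (to_xy (a q))).
  apply: eq_bigr => m _; rewrite mul_at exp_at -mul_scalar_mx; congr (_ *m _).
  by elim: (val m) => [//|m' IH]; rewrite !exprS -IH scalar_mxM.
rewrite -e exchange_big /=; apply: eq_bigr => i _.
have lE (k : nat) : (l ^ (k%:Z - r%:Z))%R = l ^+ k / l ^+ r by rewrite expfzDr // exprnN.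
have lC : Num.conj l = l^-1.
  by apply: (mulfI l0); rewrite -normCK l1 expr1n divff.
rewrite /y scale_at PhiE // adjoint_sumZ mulmx_suml; apply: eq_bigr => k _.
rewrite -scalemxAl -scalemxAr scalerA !lE; congr (_ *: _).
rewrite rmorphM fmorphV !rmorphXn /= lC !exprVn invrK.
by field; rewrite !expf_neq0.
Qed.

(** After (r + s + 1) (t + 1) steps the left-hand side is the coefficient of a
    pole of order 2 (r + s + 1), more than the bound r + s. *)
Lemma first_return_exp0 q : chart_dom a q ->
  first_return a phi t q ^+ (r + s).+1 *m hproj (phi q) = 0.
Proof.
move=> aq; rewrite -return_at //.
have sN : (r + s <= (r + s).+1 * t.+1)%N by nia.
have W l (l1 : `|l| = 1) := gauge ((r + s).+1 * t.+1) l1 aq.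
have := @laurent_coef_eq0 _ _ _ _
  (fun m => pole_coef d (P 0%N) ((r + s).+1 * t.+1) m (to_xy (a q)))
  (fun k i => (C (k%:Z - r%:Z) q)^t* *m
     iter ((r + s).+1 * t.+1) d (C' i * P 0%N) (to_xy (a q))) sN W.
by apply; nia.
Qed.
End FirstReturn.

Theorem theorem4p10 (R : realType) (M : riemannSurface R) (n k : nat)
    (phi : M -> Csubspace R n)
    (phi_dim : forall p : M, \dim (phi p) = k)
    (phi_harmonic : harmonic_map (fun p : M => cartan (phi p)))
    (phi_finite : finite_uniton_number (fun p : M => cartan (phi p))) :
  strongly_isotropic phi \/
  exists t : nat, finite_isotropy_order phi t /\
    nilpotent_on phi (fun a p => first_return a phi t p).
Proof.
have [si|nsi] := pselect (strongly_isotropic phi); [by left|right].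
have sphi : smooth_bundle phi by apply: smooth_bundle_cartan; case: phi_harmonic.
have [t [p [t_order no]]] := isotropy_order_exists sphi nsi.
exists t; split=> //.
have [t1 up _] := t_order.
have gP i : (i < t)%N -> is_gauss (gauss_iter i phi) (gauss_iter i.+1 phi).
  by move=> it; apply: (gauss_iter_is_gauss _ no); exact: ltnW.
have [Phi Phi_ext [r [s [C sC PhiE]]]] := phi_finite.
exists (r + s).+1 => a q v aa aq; rewrite hproj_id => /eqP <-.
by rewrite mulmxA (first_return_exp0 sphi t1 up gP aa Phi_ext sC PhiE aq) mul0mx.
Qed.
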